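(* Let $(R,\mathfrak{m})$ be a commutative Noetherian local ring and let $x_1,\ldots,x_s$ be a filter regular sequence in $R$. Then there exists a positive integer $N$ such that for arbitrary elements $\varepsilon_1,\ldots,\varepsilon_s$ in $\mathfrak{m}^N$ we have $$\ell(H_i(R_{x_1',\ldots,x_s'})) = \ell(H_i(R_{x_1,\ldots,x_s}))$$ for all $i \geq 1$, where $x_i'=x_i+\varepsilon_i$, $i=1,\ldots,s$.
   Context: All rings are commutative, Noetherian, with identity. A sequence $x_1,\ldots,x_s$ in a local ring $(R,\mathfrak{m})$ is called filter regular if $\operatorname{Supp}\left(\frac{(x_1,\ldots,x_{i-1}):x_i}{(x_1,\ldots,x_{i-1})}\right)\subseteq\{\mathfrak{m}\}$ for all $i=1,\ldots,s$ (for $i=1$ the ideal $(x_1,\ldots,x_{i-1})$ is $0$). Equivalently, the image of each $x_i$ in $R/(x_1,\ldots,x_{i-1})$ avoids every associated prime of that ring other than the maximal ideal. $\ell(M)$ denotes the length of an $R$-module $M$. $R_{x_1,\ldots,x_s}=R_{x_1}\otimes\cdots\otimes R_{x_s}$ denotes the Koszul complex of $x_1,\ldots,x_s$ over $R$, where $R_x$ is the complex $0\to R\xrightarrow{x}R\to 0$ in degrees $1$ and $0$; $H_i(R_{x_1,\ldots,x_s})$ is its $i$-th homology. For a filter regular sequence, these modules have finite length for $i\ge 1$. *)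

(* Defs.v *)
From HB Require Import structures.
From mathcomp Require Import all_boot all_order all_algebra.
From mathcomp Require Import ring_quotient generic_quotient.
From mathcomp Require Import boolp.

Set Implicit Arguments.
Unset Strict Implicit.
Unset Printing Implicit Defensive.

Import GRing.Theory.

Local Open Scope ring_scope.
Local Open Scope quotient_scope.

(* Subsets are boolean predicates, and a Prop-valued condition is turned into  *)
(* one by the classical truth value `[< P >]; thus submodClosed and idealr     *)
(* range over all submodules and all proper ideals.                            *)

Section Quotients.
Variables (R : pzRingType) (V : lmodType R).

Definition submod_type (A : submodClosed V) : Type := {x : V | x \in A}.

HB.instance Definition _ (A : submodClosed V) := [isSub of submod_type A for @sval _ _].
HB.instance Definition _ (A : submodClosed V) := [Choice of submod_type A by <:].
HB.instance Definition _ (A : submodClosed V) :=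
  [SubChoice_isSubLmodule of submod_type A by <:].

(* submodClosed does not include closure under opposite, which                 *)
(* Quotient.quot requires.                                                     *)
Definition submod_pred (B : submodClosed V) : {pred V} := B.

Fact submod_pred_closed B : zmod_closed (submod_pred B).
Proof.
by split=> [|x y xB yB]; rewrite /submod_pred -?scaleN1r ?rpredD ?rpredZ ?rpred0.
Qed.
HB.instance Definition _ B :=
  GRing.isZmodClosed.Build V (submod_pred B) (submod_pred_closed B).

Definition quot_mod (B : submodClosed V) : Type := Quotient.quot (submod_pred B).

Section QuotMod.
Variable B : submodClosed V.
Local Notation Q := (Quotient.quot (submod_pred B)).

HB.instance Definition _ := GRing.Zmodule.on (quot_mod B).

Definition quot_scale (a : R) (u : quot_mod B) : quot_mod B :=
  \pi_Q (a *: repr (u : Q)).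

Lemma quot_scaleE a x :
  quot_scale a (\pi_Q x) = \pi_Q (a *: x).
Proof.
apply/eqP; rewrite /quot_scale -Quotient.idealrBE -scalerBr /submod_pred.
apply: rpredZ; rewrite -[_ \in _]/(_ \in submod_pred B).
by rewrite Quotient.idealrBE reprK.
Qed.

Lemma quot_scalerA a b u :
  quot_scale a (quot_scale b u) = quot_scale (a * b) u.
Proof. by rewrite {1}[quot_scale b u]/quot_scale quot_scaleE scalerA. Qed.

Lemma quot_scale1r : left_id 1 quot_scale.
Proof. by move=> u; rewrite /quot_scale scale1r reprK. Qed.

Lemma quot_scalerDr : right_distributive quot_scale +%R.
Proof.
move=> a u v; rewrite -[u](@reprK _ Q) -[v](@reprK _ Q).
rewrite !quot_scaleE.
rewrite -[X in quot_scale _ X](raddfD (\pi_Q : V -> Q)).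
by rewrite quot_scaleE scalerDr raddfD.
Qed.

Lemma quot_scalerDl u : {morph quot_scale^~ u : a b / a + b}.
Proof. by move=> a b; rewrite /quot_scale scalerDl raddfD. Qed.

HB.instance Definition _ := GRing.Zmodule_isLmodule.Build R (quot_mod B)
  quot_scalerA quot_scale1r quot_scalerDr quot_scalerDl.
End QuotMod.
End Quotients.

Section Subquot.
Variables (R : pzRingType) (V : lmodType R) (A B : submodClosed V).

Definition sub_preim : {pred submod_type A} := [pred x | val x \in B].

Fact sub_preim_closed : submod_closed sub_preim.
Proof.
split=> [|a u v]; first by rewrite inE raddf0 rpred0.
by rewrite !inE => uB vB; rewrite linearP rpredD ?rpredZ.
Qed.
HB.instance Definition _ :=
  GRing.isSubmodClosed.Build R (submod_type A) sub_preim sub_preim_closed.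

(* A / (A :&: B); this is A / B when B is contained in A. *)
Definition subquot : lmodType R := quot_mod sub_preim.
End Subquot.

(* Length of a module: the supremum in nat + {oo} of the n such that there is  *)
(* a strict chain M_0 < M_1 < ... < M_n of submodules.  Since chains can be    *)
(* truncated, when the supremum is finite it is the least n for which there is *)
(* no strict chain M_0 < ... < M_n.+1.                                         *)
Section Length.
Variables (R : pzRingType) (V : lmodType R).

Definition strict_chain (n : nat) (C : nat -> submodClosed V) : Prop :=
  forall k, (k < n)%N ->
    {subset C k <= C k.+1} /\ exists2 v, v \in C k.+1 & v \notin C k.

Definition no_chain : pred nat :=
  [pred n | `[< ~ exists C, strict_chain n.+1 C >]].

(* None stands for infinite length. *)
Definition mlength : option nat :=
  match pselect (exists n, no_chain n) with
  | left bounded => Some (ex_minn bounded)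
  | right _ => None
  end.
End Length.

Section Support.
Variables (R : comNzRingType) (V : lmodType R).

(* Equality of the fractions u.1 / u.2 and v.1 / v.2 in the localization V_p. *)
Definition frac_eq (p : prime_idealr R) (u v : V * R) : Prop :=
  exists2 t, t \notin p & t *: (v.2 *: u.1 - u.2 *: v.1) = 0.

(* The support is the set of primes p with V_p <> 0. *)
Definition in_supp (p : prime_idealr R) : Prop :=
  exists2 u : V * R, u.2 \notin p & ~ frac_eq p u (0, 1).
End Support.

Section Ideals.
Variable R : comNzRingType.

Definition ideal_gen (s : seq R) : {pred R^o} :=
  [pred r | `[< exists c : 'I_(size s) -> R, r = \sum_(i < size s) c i * s`_i >]].

Fact ideal_gen_closed s : submod_closed (ideal_gen s).
Proof.
split=> [|a u v].
  by rewrite inE; apply/asboolP; exists (fun=> 0); rewrite big1 // => i _; rewrite mul0r.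
rewrite !inE => /asboolP[c ->] /asboolP[d ->]; apply/asboolP.
exists (fun i => a * c i + d i).
rewrite scaler_sumr -big_split; apply: eq_bigr => i _ /=.
by rewrite mulrDl -mulrA.
Qed.
HB.instance Definition _ s :=
  GRing.isSubmodClosed.Build R R^o (ideal_gen s) (ideal_gen_closed s).

Definition colon (I : submodClosed R^o) (a : R) : {pred R^o} :=
  [pred r : R^o | (r : R) * a \in I].

Fact colon_closed I a : submod_closed (colon I a).
Proof.
split=> [|b u v]; first by rewrite inE mul0r; exact: (rpred0 I).
rewrite !inE => uI vI; rewrite mulrDl -[b *: u]/(b * u) -mulrA.
by apply: (@rpredD _ I); [exact: (@rpredZ _ _ I b) | ].
Qed.
HB.instance Definition _ I a :=
  GRing.isSubmodClosed.Build R R^o (colon I a) (colon_closed I a).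

Lemma colon_sub (I : submodClosed R^o) a : {subset I <= colon I a}.
Proof. by move=> u uI; rewrite inE mulrC; exact: (@rpredZ _ _ I a). Qed.

Definition ideal_mul (I J : {pred R}) : {pred R} :=
  [pred r | `[< exists n (a b : 'I_n -> R),
     [/\ forall i, a i \in I, forall i, b i \in J
       & r = \sum_(i < n) a i * b i] >]].

Definition ideal_pow (I : {pred R}) (n : nat) : {pred R} :=
  iter n (ideal_mul I) predT.

Definition noetherian : Prop :=
  forall I : submodClosed R^o, exists s : seq R, I =i ideal_gen s.

(* idealr is the type of proper ideals. *)
Definition maximal_ideal (m : idealr R) : Prop :=
  forall J : idealr R, {subset m <= J} -> J =i m.

Definition local_ring (m : idealr R) : Prop :=
  maximal_ideal m /\ forall n : idealr R, maximal_ideal n -> n =i m.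

Definition filter_regular (m : idealr R) (x : seq R) : Prop :=
  forall i, (i < size x)%N -> forall p : prime_idealr R,
    in_supp (subquot (colon (ideal_gen (take i x)) x`_i) (ideal_gen (take i x))) p ->
    p =i m.
End Ideals.

(* Complexes of free modules of finite total rank with a homogeneous basis, in *)
(* nonnegative degrees; cdiff b c is the coefficient of c in the differential  *)
(* of b.                                                                       *)
Record freeCpx (R : pzRingType) := FreeCpx {
  cbasis : finType;
  cdeg : cbasis -> nat;
  cdiff : cbasis -> cbasis -> R;
  cdiff_deg : forall b c, cdiff b c != 0 -> cdeg b = (cdeg c).+1;
  cdiff_sq : forall b c, \sum_e cdiff b e * cdiff e c = 0
}.
Arguments cdeg {R C} : rename.
Arguments cdiff {R C} : rename.
Arguments cdiff_deg {R} C : rename.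
Arguments cdiff_sq {R} C : rename.

Section Homology.
Variables (R : comNzRingType) (C : freeCpx R).

Definition chain : lmodType R := {ffun cbasis C -> R^o}.

Definition bdry (f : chain) : chain := [ffun c => \sum_b f b * cdiff b c].

Fact bdry_linear : linear bdry.
Proof.
move=> a f g; apply/ffunP => c; rewrite !ffunE scaler_sumr -big_split.
by apply: eq_bigr => b _ /=; rewrite !ffunE mulrDl -scalerAl.
Qed.
HB.instance Definition _ := GRing.isLinear.Build R chain chain *:%R bdry bdry_linear.

Definition homog (n : nat) : {pred chain} :=
  [pred f : chain | [forall b, (f b != 0) ==> (cdeg b == n)]].

Fact homog_closed n : submod_closed (homog n).
Proof.
split=> [|a f g]; first by rewrite inE; apply/forallP => b; rewrite ffunE eqxx.
rewrite !inE => /forallP hf /forallP hg; apply/forallP => b.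
rewrite !ffunE; apply/implyP; apply: contraNT => nb.
have/eqP-> : f b == 0 by apply: contraNT nb; exact/implyP.
have/eqP-> : g b == 0 by apply: contraNT nb; exact/implyP.
by rewrite scaler0 addr0.
Qed.
HB.instance Definition _ n :=
  GRing.isSubmodClosed.Build R chain (homog n) (homog_closed n).

Definition cycles (n : nat) : {pred chain} :=
  [pred f | (f \in homog n) && (bdry f == 0)].

Fact cycles_closed n : submod_closed (cycles n).
Proof.
split=> [|a f g]; first by apply/andP; rewrite rpred0 linear0 eqxx.
move=> /andP[hf /eqP f0] /andP[hg /eqP g0]; apply/andP.
by rewrite rpredD ?rpredZ // bdry_linear f0 g0 scaler0 addr0 eqxx.
Qed.
HB.instance Definition _ n :=
  GRing.isSubmodClosed.Build R chain (cycles n) (cycles_closed n).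

Definition boundaries (n : nat) : {pred chain} :=
  [pred f | `[< exists2 g, g \in homog n.+1 & f = bdry g >]].

Fact boundaries_closed n : submod_closed (boundaries n).
Proof.
split=> [|a f g].
  by rewrite inE; apply/asboolP; exists 0; rewrite ?rpred0 ?linear0.
move=> /asboolP[f' hf ->] /asboolP[g' hg ->].
by apply/asboolP; exists (a *: f' + g'); rewrite ?rpredD ?rpredZ ?linearP.
Qed.
HB.instance Definition _ n :=
  GRing.isSubmodClosed.Build R chain (boundaries n) (boundaries_closed n).

Lemma boundaries_sub n : {subset boundaries n <= cycles n}.
Proof.
move=> _ /asboolP[g /forallP hg ->]; rewrite inE; apply/andP; split.
  rewrite inE; apply/forallP => c; rewrite ffunE; apply/implyP.
  apply: contraNT => nc; apply/eqP; apply: big1 => b _.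
  have [-> | gb] := eqVneq (g b) 0; first exact: mul0r.
  have [-> | dbc] := eqVneq (cdiff b c) 0; first exact: mulr0.
  have /eqP := implyP (hg b) gb; rewrite (cdiff_deg _ _ _ dbc) => -[/eqP].
  by rewrite (negPf nc).
apply/eqP/ffunP => c; rewrite !ffunE.
under eq_bigr => b _ do rewrite ffunE mulr_suml.
rewrite exchange_big /= big1 // => b _.
under eq_bigr => e _ do rewrite -mulrA.
by rewrite -mulr_sumr cdiff_sq mulr0.
Qed.

Definition homology (n : nat) : lmodType R := subquot (cycles n) (boundaries n).
End Homology.

Section Koszul.
Variable R : comNzRingType.

(* The basis of the tensor product consists of the b (x) b', and               *)
(*   d (b (x) b') = d b (x) b' + (-1) ^+ deg b b (x) d b'.                     *)
Section Tensor.
Variables C D : freeCpx R.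

Definition tdeg (b : cbasis C * cbasis D) : nat := (cdeg b.1 + cdeg b.2)%N.

Definition tdiff (b c : cbasis C * cbasis D) : R :=
  cdiff b.1 c.1 *+ (b.2 == c.2) +
  (-1) ^+ cdeg b.1 * cdiff b.2 c.2 *+ (b.1 == c.1).

Fact tdiff_deg b c : tdiff b c != 0 -> tdeg b = (tdeg c).+1.
Proof.
case: b c => [b b'] [c c']; rewrite /tdiff /tdeg /=.
have [-> | nb] := eqVneq b c; have [-> | nb'] := eqVneq b' c';
  rewrite ?mulr1n ?mulr0n ?addr0 ?add0r ?eqxx //.
- have [-> | /cdiff_deg/n_Sn //] := eqVneq (cdiff c c) 0.
  have [-> | /cdiff_deg/n_Sn //] := eqVneq (cdiff c' c') 0.
  by rewrite mulr0 addr0 eqxx.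
- have [-> | /cdiff_deg->] := eqVneq (cdiff b' c') 0; first by rewrite mulr0 eqxx.
  by rewrite addnS.
- by move/cdiff_deg ->; rewrite addSn.
Qed.

Fact tdiff_sq b c : \sum_e tdiff b e * tdiff e c = 0.
Proof.
case: b c => [b b'] [c c'].
rewrite -(pair_bigA _ (fun e e' => tdiff (b, b') (e, e') * tdiff (e, e') (c, c'))) /=.
rewrite /tdiff /=.
have pick (I : finType) (F : I -> R) i :
    (forall j, j != i -> F j = 0) -> \sum_j F j = F i.
  by move=> F0; rewrite (bigD1 i) //= big1 ?addr0 // => j /F0.
under eq_bigr => e _ do under eq_bigr => e' _ do rewrite mulrDl !mulrDr.
under eq_bigr => e _ do rewrite !big_split.
rewrite !big_split /=.
set S1 := (X in X + _ + _); set S2 := (X in _ + X + _).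
set S3 := (X in _ + (X + _)); set S4 := (X in _ + (_ + X)).
have -> : S1 = 0.
  rewrite /S1; transitivity ((\sum_e cdiff b e * cdiff e c) *+ (b' == c')).
    rewrite -sumrMnl; apply: eq_bigr => e _.
    rewrite (pick _ _ b') => [|e' /negPf ne]; first by rewrite eqxx mulrnAr.
    by rewrite eq_sym ne mul0r.
  by rewrite cdiff_sq mul0rn.
have -> : S4 = 0.
  rewrite /S4 (pick _ _ b) => [|e /negPf ne]; last first.
    by rewrite eq_sym ne big1 // => e' _; rewrite mul0r.
  under eq_bigr => e' _ do rewrite eqxx mulr1n mulrnAr mulrACA.
  by rewrite sumrMnl -mulr_sumr cdiff_sq mulr0 mul0rn.
have -> : S2 = cdiff b c * ((-1) ^+ cdeg c * cdiff b' c').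
  rewrite /S2 (pick _ _ c) => [|e /negPf ne]; last first.
    by rewrite big1 // => e' _; rewrite ne mulr0.
  rewrite (pick _ _ b') => [|e' /negPf ne]; first by rewrite !eqxx.
  by rewrite eq_sym ne mul0r.
have -> : S3 = (-1) ^+ cdeg b * cdiff b' c' * cdiff b c.
  rewrite /S3 (pick _ _ b) => [|e /negPf ne]; last first.
    by rewrite big1 // => e' _; rewrite eq_sym ne mul0r.
  rewrite (pick _ _ c') => [|e' /negPf ne]; first by rewrite !eqxx.
  by rewrite ne mulr0.
have [-> | dbc] := eqVneq (cdiff b c) 0; first by rewrite mul0r mulr0 !addr0.
rewrite (cdiff_deg _ _ _ dbc) exprS mulN1r !mulNr add0r addr0.
by rewrite [X in _ - X]mulrC subrr.
Qed.

Definition tensor : freeCpx R := FreeCpx tdiff_deg tdiff_sq.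
End Tensor.

(* 0 -> R -> R -> 0 in degrees 1 (basis element true) and 0 (false). *)
Section Koszul1.
Variable x : R.

Definition kdiff (b c : bool) : R := if b && ~~ c then x else 0.

Fact kdiff_deg b c : kdiff b c != 0 -> nat_of_bool b = (nat_of_bool c).+1.
Proof. by case: b c => -[]; rewrite /kdiff ?eqxx. Qed.

Fact kdiff_sq b c : \sum_e kdiff b e * kdiff e c = 0.
Proof. by rewrite big_bool /kdiff; case: b c => -[]; rewrite /= !(mul0r, mulr0, addr0). Qed.

Definition koszul1 : freeCpx R := FreeCpx kdiff_deg kdiff_sq.
End Koszul1.

(* R in degree 0, the unit of the tensor product. *)
Definition cpx1 : freeCpx R.
Proof.
apply: (@FreeCpx R unit (fun=> 0%N) (fun _ _ => 0)) => [b c|b c].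
- by rewrite eqxx.
- by rewrite big1 // => e _; rewrite mul0r.
Defined.

Definition koszul (x : seq R) : freeCpx R :=
  foldr (fun a K => tensor (koszul1 a) K) cpx1 x.
End Koszul.

(* Main.v *)
Require Import Defs.
From HB Require Import structures.
From mathcomp Require Import all_boot all_order all_algebra.
From mathcomp Require Import ring_quotient boolp.
From mathcomp Require Import zify.

Set Implicit Arguments.
Unset Strict Implicit.
Unset Printing Implicit Defensive.

Import GRing.Theory.

Local Open Scope ring_scope.

(** Write d_x for the Koszul differential of x.  All these differentials act on
    one free module, and replacing x_j by x_j + e replaces d_x by
    d' = d_x + e iota, where iota is contraction with the j-th dual basis vector;
    iota has square zero and anticommutes with d_x.

    Filter regularity gives a power of m that kills the homology in positive
    degrees ([koszul_annihilated]).  With the Artin-Rees lemma this gives a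
    constant c such that, in each degree i > 0, cycles and boundaries lying in
    m ^ n bound chains lying in m ^ (n - c), for n >= c in the case of cycles
    ([ar_bound_ex]).

    Let e lie in m ^ N with N > c.  If z is an i-cycle for d_x, then e z lies in
    m ^ N, so e z = d_x u with u in m ^ (N - c), and z + iota u is a cycle for d':
    the terms e iota z and d_x iota u = - iota d_x u cancel
    ([lift_cycle]).  So each cycle of d_x is close to a cycle of d'.  From this
    and Krull's intersection theorem the bound c holds for d' as well
    ([ar_bound_perturb]), with no loss.  The situation is then symmetric in the
    two sequences.  Identify a class for d_x with a class for d' when they have
    representatives congruent modulo m ^ c.  For N > 2 c this identification is a
    bijection compatible with the module structures, because cycles lift and
    cycles in m ^ c are boundaries ([close_cycles_corr]), so the lengths agree
    ([mlength_perturb]).  As c does not change, the elements of the sequence can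
    be perturbed one after the other with the same N.

    The Artin-Rees lemma is derived from Hilbert's basis theorem applied to the
    Rees module, whose polynomial variables are handled as commuting operators
    ([hilbert_basis], [artin_rees]). *)

(** * Submodules and finite generation *)

Definition is_submod (R : pzRingType) (V : lmodType R) (L : V -> Prop) :=
  L 0 /\ forall a u v, L u -> L v -> L (a *: u + v).

Section Submodules.
Variables (R : pzRingType) (V : lmodType R) (L : V -> Prop).
Hypothesis hL : is_submod L.

Lemma submod0 : L 0. Proof. by case: hL. Qed.

Lemma submodZ a u : L u -> L (a *: u).
Proof. by case: hL => L0 LP Lu; rewrite -[_ *: _]addr0; apply: LP. Qed.

Lemma submodD u v : L u -> L v -> L (u + v).
Proof. by case: hL => L0 LP Lu Lv; rewrite -[u]scale1r; apply: LP. Qed.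

Lemma submodN u : L u -> L (- u).
Proof. by rewrite -scaleN1r; apply: submodZ. Qed.

Lemma submodB u v : L u -> L v -> L (u - v).
Proof. by move=> Lu Lv; apply: submodD => //; apply: submodN. Qed.

Lemma submod_sum (I : Type) (s : seq I) (P : pred I) (F : I -> V) :
  (forall i, P i -> L (F i)) -> L (\sum_(i <- s | P i) F i).
Proof. by move=> LF; apply: big_ind => //; [apply: submod0 | apply: submodD]. Qed.

End Submodules.

(** Finite generation of modules carrying endomorphisms [U 0, ..., U r.-1] is
    phrased without linear combinations: every stable submodule that contains
    the generators contains everything.  When the [U i] commute, these are the
    modules over a polynomial ring in r variables; treating the variables as
    operators avoids all manipulation of multivariate polynomials. *)
Section Operators.
Variables (R : pzRingType) (V : lmodType R) (U : nat -> V -> V).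

Definition stable (r : nat) (L : V -> Prop) :=
  is_submod L /\ forall i, (i < r)%N -> forall v, L v -> L (U i v).

Definition fin_gen (r : nat) (L : V -> Prop) :=
  exists s : seq V, (forall v, v \in s -> L v) /\
    forall M, stable r M -> (forall v, v \in s -> M v) -> forall v, L v -> M v.

Definition noeth (r : nat) (W : V -> Prop) :=
  forall L, stable r L -> (forall v, L v -> W v) -> fin_gen r L.

Hypothesis linU : forall i, linear (U i).
Hypothesis commU : forall i j v, U i (U j v) = U j (U i v).

Variables (r : nat) (W : V -> Prop).
Hypotheses (stW : stable r W) (noethW : noeth r W).
Let X := U r.

(** Polynomials of degree less than n in the last operator, with coefficients
    in [W]. *)
Fixpoint deg_lt (n : nat) (p : V) : Prop :=
  if n is n'.+1 then exists w, W w /\ deg_lt n' (p - iter n' X w) else p = 0.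

Lemma iter_lin n : linear (iter n X).
Proof. by move=> a u v; elim: n => //= n ->; rewrite /X linU. Qed.

Lemma iterUX n i v : U i (iter n X v) = iter n X (U i v).
Proof. by elim: n => //= n IH; rewrite commU IH. Qed.

Lemma op0 i : U i 0 = 0.
Proof. by have := linU i (-1) 0 0; rewrite scaler0 addr0 scaleN1r addNr. Qed.

Lemma opB i u v : U i (u - v) = U i u - U i v.
Proof. by rewrite addrC -scaleN1r linU scaleN1r addrC. Qed.

Lemma iterX0 n : iter n X 0 = 0.
Proof. by elim: n => //= n ->; apply: op0. Qed.

Lemma stable_deg_lt n : stable r (deg_lt n).
Proof.
elim: n => [|n [[IH0 IHP] IHU]] /=.
  split=> [|i _ v ->]; last exact: op0.
  by split=> // a u v -> ->; rewrite scaler0 addr0.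
have [smW WU] := stW; split; first split.
- by exists 0; split; [apply: submod0 | rewrite iterX0 subr0].
- move=> a u v [w [Ww uw]] [w' [Ww' vw']]; exists (a *: w + w').
  split; first by apply: smW.2.
  by rewrite iter_lin opprD addrACA -scalerBr; apply: IHP.
- move=> i ltir v [w [Ww vw]]; exists (U i w); split; first exact: WU.
  by rewrite -iterUX -opB; apply: IHU.
Qed.

Lemma deg_ltX n p : deg_lt n p -> deg_lt n.+1 (X p).
Proof.
elim: n p => [|n IH] p /= => [->|[w [Ww pw]]].
  by exists 0; split; [case: stW => -[] | rewrite /X op0 subr0].
by exists w; split=> //; rewrite -opB; apply: IH.
Qed.

Lemma deg_ltS n p : deg_lt n p -> deg_lt n.+1 p.
Proof.
by exists 0; split; [case: stW => -[] | rewrite iterX0 subr0].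
Qed.

Lemma deg_lt_iterX k n p : deg_lt n p -> deg_lt (k + n) (iter k X p).
Proof. by elim: k => //= k IH /IH/deg_ltX. Qed.

Definition poly_over (p : V) := exists n, deg_lt n p.

Lemma deg_lt_leq m n p : (m <= n)%N -> deg_lt m p -> deg_lt n p.
Proof. by move/subnK <-; elim: (n - m)%N => //= k IH /IH/deg_ltS. Qed.

Lemma stable_poly_over : stable r.+1 poly_over.
Proof.
split; first split; first by exists 0%N.
  move=> a u v [n hu] [k hv]; exists (maxn n k).
  have [[_ hP] _] := stable_deg_lt (maxn n k).
  by apply: hP; [apply: deg_lt_leq hu | apply: deg_lt_leq hv];
    rewrite (leq_maxl, leq_maxr).
move=> i; rewrite ltnS leq_eqVlt => /predU1P[->|ltir] v [n hv].
  by exists n.+1; apply: deg_ltX.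
by exists n; apply: (stable_deg_lt n).2.
Qed.

Lemma poly_over_base w : W w -> poly_over w.
Proof. by exists 1%N, w; rewrite /= subrr. Qed.

Section LeadingCoefs.
Variable L : V -> Prop.
Hypothesis stL : stable r.+1 L.

Definition lead_coefs (n : nat) (w : V) :=
  W w /\ exists p, L p /\ deg_lt n (p - iter n X w).

Lemma stableW M : stable r.+1 M -> stable r M.
Proof. by case=> hM MU; split=> // i /ltnW; apply: MU. Qed.

Lemma stable_lead_coefs n : stable r (lead_coefs n).
Proof.
have [smW WU] := stW; have [smL LU] := stableW stL.
have [smD DU] := stable_deg_lt n.
split; first split.
- split; first exact: submod0.
  by exists 0; rewrite iterX0 subr0; split; apply: submod0.
- move=> a u v [Wu [p [Lp pu]]] [Wv [q [Lq qv]]]; split; first exact: smW.2.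
  exists (a *: p + q); split; first exact: smL.2.
  by rewrite iter_lin opprD addrACA -scalerBr; apply: smD.2.
- move=> i ltir v [Wv [p [Lp pv]]]; split; first exact: WU.
  exists (U i p); split; first exact: LU.
  by rewrite -iterUX -opB; apply: DU.
Qed.

Lemma lead_coefs_leq n k w : (n <= k)%N -> lead_coefs n w -> lead_coefs k w.
Proof.
move/subnK <-; elim: (k - n)%N => //= {}k IH /IH[Ww [p [Lp pw]]]; split=> //.
exists (X p); split; first by apply: stL.2.
by rewrite -opB; apply: deg_ltX.
Qed.

End LeadingCoefs.

Lemma lift_gens (L : V -> Prop) n (s : seq V) :
  (forall w, w \in s -> lead_coefs L n w) ->
  exists T : seq V, (forall p, p \in T -> L p) /\
    forall w, w \in s -> exists p, [/\ p \in T, L p & deg_lt n (p - iter n X w)].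
Proof.
elim: s => [|w s IH] hs; first by exists [::].
have [|T [LT hT]] := IH; first by move=> u us; apply: hs; rewrite inE us orbT.
have [_ [p [Lp pw]]] := hs w (mem_head _ _).
exists (p :: T); split=> [q|u]; rewrite inE => /predU1P[-> //|]; first exact: LT.
  by exists p; rewrite mem_head.
by case/hT=> q [qT Lq hq]; exists q; rewrite inE qT orbT.
Qed.

Lemma lead_coefs_gens (L : V -> Prop) (d : nat) : stable r.+1 L ->
  exists T : seq V, (forall p, p \in T -> L p) /\
    forall M, stable r.+1 M -> (forall p, p \in T -> M p) ->
    forall n w, (n < d)%N -> lead_coefs L n w ->
      lead_coefs (fun p => L p /\ M p) n w.
Proof.
move=> stL; elim: d => [|d [T [LT hT]]]; first by exists [::].
have [|s [hs gens]] := noethW (stable_lead_coefs stL d); first by move=> v [].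
have [T' [LT' hT']] := lift_gens hs.
exists (T ++ T'); split=> [p|M stM TM n w].
  by rewrite mem_cat => /orP[/LT|/LT'].
rewrite ltnS leq_eqVlt => /predU1P[->|ltnd]; last first.
  by apply: hT => // p pT; apply: TM; rewrite mem_cat pT.
apply: gens => [|v vs].
  apply: stable_lead_coefs; case: stL stM => -[L0 LP] LU [[M0 MP] MU].
  split=> [|i ltir v [Lv Mv]]; last by split; [apply: LU | apply: MU].
  by split=> // a u v [Lu Mu] [Lv Mv]; split; [apply: LP | apply: MP].
split; first by case: (hs _ vs).
have [p [pT' Lp hp]] := hT' _ vs; exists p; split=> //; split=> //.
by apply: TM; rewrite mem_cat pT' orbT.
Qed.

(** Hilbert's basis theorem: the leading coefficients of degree n of elements
    of [L] form a stable submodule of [W] that increases with n, hence is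
    constant from some degree d on; lifting generators in all degrees up to d
    generates [L]. *)
Lemma hilbert_basis : noeth r.+1 poly_over.
Proof.
move=> L stL LW; pose Linf w := exists n, lead_coefs L n w.
have stLinf : stable r Linf.
  split; first split.
  - by exists 0%N; apply: submod0 (stable_lead_coefs stL 0).1.
  - move=> a u v [n hu] [k hv]; exists (maxn n k).
    by apply: (stable_lead_coefs stL _).1.2;
      [apply: lead_coefs_leq hu | apply: lead_coefs_leq hv];
      rewrite // (leq_maxl, leq_maxr).
  - by move=> i ltir v [n hv]; exists n; apply: (stable_lead_coefs stL _).2.
have [|s [hs gens]] := noethW stLinf; first by move=> v [n []].
have [d hd] : exists d, forall w, w \in s -> lead_coefs L d w.
  elim: s hs {gens} => [|w s IH] hs; first by exists 0%N.
  have [|d hd] := IH; first by move=> u us; apply: hs; rewrite inE us orbT.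
  have [n hw] := hs w (mem_head _ _); exists (maxn n d) => u.
  by rewrite inE => /predU1P[->|/hd hu];
    [apply: lead_coefs_leq hw | apply: lead_coefs_leq hu];
    rewrite // (leq_maxl, leq_maxr).
have Linfd w : Linf w -> lead_coefs L d w.
  exact: gens (stable_lead_coefs stL d) hd w.
have [T [LT hT]] := lead_coefs_gens d.+1 stL.
exists T; split=> // M stM TM v Lv; have [n vn] := LW v Lv.
elim: n => [|n IH] in v Lv vn *; first by rewrite vn; apply: submod0 stM.1.
have [w [Ww vw]] := vn.
suff [p [Lp Mp hp]] : exists p, [/\ L p, M p & deg_lt n (p - iter n X w)].
  rewrite -(subrK p v); apply: (submodD stM.1) => //; apply: IH.
    exact: submodB stL.1 _ _ Lv Lp.
  have := submodB (stable_deg_lt n).1 vw hp.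
  by rewrite opprB addrA subrK.
have hw : lead_coefs L n w by split=> //; exists v.
have [ltnd|ltdn] := ltnP n d.+1.
  by have [_ [p [[Lp Mp] hp]]] := hT M stM TM n w ltnd hw; exists p.
have [|_ [p [[Lp Mp] hp]]] := hT M stM TM d w (ltnSn d); first by apply: Linfd; exists n.
rewrite -(subnK (ltnW ltdn)); set k := (n - d)%N; exists (iter k X p); split.
- by elim: k => //= k; apply: stL.2.
- by elim: k => //= k; apply: stM.2.
- have iterXB (a b : V) : iter k X (a - b) = iter k X a - iter k X b.
    by rewrite addrC -scaleN1r iter_lin scaleN1r addrC.
  by rewrite iterD -iterXB; apply: deg_lt_iterX.
Qed.

End Operators.

Section Noetherian.
Variable R : pzRingType.

Lemma stable0 (V : lmodType R) (U : nat -> V -> V) (L : V -> Prop) :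
  stable U 0 L <-> is_submod L.
Proof. by split=> [[]|]. Qed.

Lemma eq_submod (V : lmodType R) (L M : V -> Prop) :
  (forall v, L v <-> M v) -> is_submod L -> is_submod M.
Proof.
move=> LM [L0 LP]; split; first exact/LM.
by move=> a u v /LM Lu /LM Lv; apply/LM; apply: LP.
Qed.

Lemma is_submodI (V : lmodType R) (L M : V -> Prop) :
  is_submod L -> is_submod M -> is_submod (fun v => L v /\ M v).
Proof.
move=> [L0 LP] [M0 MP]; split=> // a u v [Lu Mu] [Lv Mv].
by split; [apply: LP | apply: MP].
Qed.

Section Map.
Variables (V V' : lmodType R) (U : nat -> V -> V) (U' : nat -> V' -> V').
Variable phi : V -> V'.
Hypothesis phiL : linear phi.

Lemma lin_map0 : phi 0 = 0.
Proof. by have := phiL (-1) 0 0; rewrite scaler0 addr0 scaleN1r addNr. Qed.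

Lemma lin_mapB u v : phi (u - v) = phi u - phi v.
Proof. by rewrite addrC -scaleN1r phiL scaleN1r addrC. Qed.

Lemma is_submod_im (L : V -> Prop) :
  is_submod L -> is_submod (fun v' => exists2 v, L v & phi v = v').
Proof.
move=> [L0 LP]; split; first by exists 0; rewrite ?lin_map0.
move=> a _ _ [u Lu <-] [v Lv <-]; exists (a *: u + v); first exact: LP.
by rewrite phiL.
Qed.

Lemma is_submod_preim (L : V' -> Prop) :
  is_submod L -> is_submod (fun v => L (phi v)).
Proof. by case=> L0 LP; split=> [|a u v]; rewrite ?lin_map0 ?phiL //; apply: LP. Qed.

(** Lifts of generators of the image, together with generators of the
    intersection with the kernel, generate. *)
Lemma fin_gen_ext (L : V -> Prop) : is_submod L ->
  fin_gen U' 0 (fun v' => exists2 v, L v & phi v = v') ->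
  fin_gen U 0 (fun v => L v /\ phi v = 0) -> fin_gen U 0 L.
Proof.
move=> smL [s' [hs' gens']] [t [ht genst]].
have [s [Ls hs]] : exists s : seq V, (forall v, v \in s -> L v) /\
    forall v', v' \in s' -> exists2 v, v \in s & phi v = v'.
  elim: s' hs' {gens'} => [|v' s' IH] hs'; first by exists [::].
  have [|s [Ls hs]] := IH; first by move=> u us; apply: hs'; rewrite inE us orbT.
  have [v Lv phiv] := hs' v' (mem_head _ _).
  exists (v :: s); split=> [u|u']; rewrite inE => /predU1P[-> //|].
  - exact: Ls.
  - by exists v; rewrite ?mem_head.
  - by case/hs=> u us <-; exists u; rewrite // inE us orbT.
exists (s ++ t); split=> [v|M /stable0 smM hM v Lv].
  by rewrite mem_cat => /orP[/Ls|/ht[]].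
have [||u [Lu Mu] phiu] := gens' (fun v' => exists2 v, L v /\ M v & phi v = v')
  _ _ (phi v) (ex_intro2 _ _ v Lv erefl).
- by apply/stable0; apply: is_submod_im; apply: is_submodI.
- move=> v' /hs[u us <-]; exists u => //.
  by split; [apply: Ls | apply: hM; rewrite mem_cat us].
rewrite -(subrK u v); apply: submodD => //.
apply: genst => [|w wt|]; first exact/stable0; last split.
- by apply: hM; rewrite mem_cat wt orbT.
- exact: submodB.
- by rewrite lin_mapB phiu subrr.
Qed.

Lemma noeth_im (W : V -> Prop) : is_submod W ->
  noeth U 0 W -> noeth U' 0 (fun v' => exists2 v, W v & phi v = v').
Proof.
move=> smW nW L /stable0 smL LW.
have [||s [hs gens]] := nW (fun v => W v /\ L (phi v)).
- by apply/stable0; apply: is_submodI => //; apply: is_submod_preim.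
- by move=> v [].
exists [seq phi v | v <- s]; split=> [v' /mapP[v /hs[_ Lv] -> //]|].
move=> M /stable0 smM hM v' Lv'; have [v Wv phiv] := LW _ Lv'.
rewrite -phiv; apply: (gens (fun v => M (phi v))) => //.
- by apply/stable0; apply: is_submod_preim.
- by move=> u us; apply: hM; apply: map_f.
- by rewrite phiv.
Qed.

End Map.
End Noetherian.

Section BoolSubmod.
Variables (R : pzRingType) (V : lmodType R) (L : V -> Prop).

Definition prop_submod of is_submod L : {pred V} := [pred v | `[< L v >]].

Fact prop_submod_closed (hL : is_submod L) : submod_closed (prop_submod hL).
Proof.
case: hL => L0 LP; split=> [|a u v]; first by rewrite inE; apply/asboolP.
by rewrite !inE => /asboolP Lu /asboolP Lv; apply/asboolP; apply: LP.
Qed.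
HB.instance Definition _ hL :=
  GRing.isSubmodClosed.Build R V (prop_submod hL) (prop_submod_closed hL).
End BoolSubmod.

Section FreeModule.
Variables (R : comNzRingType) (hR : noetherian R).

Lemma ideal_genP (s : seq R) (r : R) :
  r \in ideal_gen s <-> exists c : nat -> R, r = \sum_(i < size s) c i * s`_i.
Proof.
rewrite inE; split=> [/asboolP[c ->]|[c ->]]; last by apply/asboolP; exists c.
exists (fun i => if insub i is Some j then c j else 0).
by apply: eq_bigr => i _; rewrite valK.
Qed.

Lemma ideal_gens (J : R^o -> Prop) : is_submod J ->
  exists s : seq R, (forall a, a \in s -> J a) /\
    forall r, J r -> exists c : nat -> R, r = \sum_(i < size s) c i * s`_i.
Proof.
move=> hJ; have [s hs] := hR (prop_submod hJ); exists s.
have Js r : J r <-> r \in ideal_gen s.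
  by rewrite -hs inE; split=> [Jr|/asboolP//]; apply/asboolP.
split=> [a /(nthP 0)[i lti <-]|r]; last by move/Js/ideal_genP.
apply/Js/ideal_genP; exists (fun j => (j == i)%:R).
rewrite (bigD1 (Ordinal lti)) //= eqxx mul1r big1 ?addr0 // => j.
by rewrite -val_eqE /= => /negPf->; rewrite mul0r.
Qed.

Lemma noeth_ring U : @noeth R R^o U 0 (fun=> True).
Proof.
move=> J /stable0 hJ _; have [s [Js gen]] := ideal_gens hJ.
exists s; split=> // M /stable0 hM Ms r /gen[c ->].
by apply: (submod_sum hM) => i _; apply: (submodZ hM (c i)); apply: Ms; apply: mem_nth.
Qed.

Variable B : finType.

(** Induction on the set of coordinates that may be nonzero: projecting to one
    coordinate reduces to an ideal and to one coordinate less. *)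
Lemma noeth_free (U : nat -> {ffun B -> R^o} -> {ffun B -> R^o}) :
  noeth U 0 (fun=> True).
Proof.
suff H (s : seq B) L : is_submod L ->
    (forall f : {ffun B -> R^o}, L f -> forall b, b \notin s -> f b = 0) -> fin_gen U 0 L.
  move=> L /stable0 hL _; apply: (H (enum B)) => // f _ b.
  by rewrite mem_enum.
elim: s => [|b s IH] in L * => hL Ls.
  exists [::]; split=> // M [[M0 _] _] _ f Lf.
  by rewrite (_ : f = 0) //; apply/ffunP => b; rewrite ffunE; apply: (Ls f).
pose phi (f : {ffun B -> R^o}) : R^o := f b.
have phiL : linear phi by move=> a f g; rewrite /phi !ffunE.
apply: (fin_gen_ext (U' := fun=> id) phiL) => //.
  by apply: noeth_ring => //; apply/stable0; apply: is_submod_im.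
apply: IH => [|f [Lf fb] c].
  apply: is_submodI => //; split; first by rewrite lin_map0.
  by move=> a f g; rewrite phiL => -> ->; rewrite scaler0 addr0.
have [-> //|neb] := eqVneq c b; move=> cs.
by apply: (Ls f Lf); rewrite inE negb_or neb.
Qed.

End FreeModule.

(** * Ideal powers and the Artin-Rees lemma *)

Section IdealPow.
Variables (R : comNzRingType) (I : {pred R}).
Local Notation Ipow := (ideal_pow I).

Lemma submod_ideal_pow n : is_submod (fun r : R^o => r \in Ipow n).
Proof.
elim: n => [|n hn]; first by split.
split=> [|c u v]; rewrite !inE.
  by apply/asboolP; exists 0%N, (fun=> 0), (fun=> 0); rewrite big_ord0; split=> // -[].
move=> /asboolP[k [a [b [Ia Ib ->]]]] /asboolP[k' [a' [b' [Ia' Ib' ->]]]].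
apply/asboolP; exists (k + k')%N.
exists (fun i => match split i with inl j => a j | inr j => a' j end).
exists (fun i => match split i with inl j => c * b j | inr j => b' j end).
split=> [i|i|].
- by case: split.
- by case: split => j //; apply: (submodZ hn c).
- rewrite big_split_ord /= scaler_sumr; congr (_ + _); apply: eq_bigr => j _.
    by rewrite (unsplitK (inl _ j)) mulrCA.
  by rewrite (unsplitK (inr _ j)).
Qed.

Lemma ideal_powS_min n (J : R^o -> Prop) : is_submod J ->
  (forall a b, a \in I -> b \in Ipow n -> J (a * b)) ->
  forall r, r \in Ipow n.+1 -> J r.
Proof.
move=> hJ Jab r; rewrite inE => /asboolP[k [a [b [Ia Ib ->]]]].
by apply: (submod_sum hJ) => i _; apply: Jab.
Qed.

Lemma submod_mulr (J : R^o -> Prop) (a : R) :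
  is_submod J -> is_submod (fun r : R^o => J (a * r)).
Proof.
case=> J0 JP; split=> [|c u v Ju Jv]; first by rewrite mulr0.
by rewrite mulrDr -[c *: u]/(c * u) mulrCA; apply: JP.
Qed.

(** This is I ^ (p + q) = I ^ p * I ^ q in the form in which it is used: what is
    closed under linear combinations need only be tested on products. *)
Lemma ideal_powD_min p q (J : R^o -> Prop) : is_submod J ->
  (forall a b, a \in Ipow p -> b \in Ipow q -> J (a * b)) ->
  forall r, r \in Ipow (p + q) -> J r.
Proof.
elim: p J => [|p IH] J hJ Jab r; first by move=> rq; rewrite -[r]mul1r; apply: Jab.
apply: ideal_powS_min => // a b Ia; apply: (IH (fun r => J (a * r))).
  exact: submod_mulr.
move=> c d cp dq; rewrite mulrA; apply: Jab => //; rewrite inE; apply/asboolP.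
by exists 1%N, (fun=> a), (fun=> c); rewrite big_ord1; split.
Qed.

Lemma ideal_powMS n a b : a \in I -> b \in Ipow n -> a * b \in Ipow n.+1.
Proof.
move=> Ia hb; rewrite inE; apply/asboolP.
by exists 1%N, (fun=> a), (fun=> b); rewrite big_ord1; split.
Qed.

Lemma ideal_powM p q a b : a \in Ipow p -> b \in Ipow q -> a * b \in Ipow (p + q).
Proof.
elim: p a => [|p IH] a ap bq; first exact: (submodZ (submod_ideal_pow q) a).
have hJ := submod_mulr b (submod_ideal_pow (p + q).+1).
rewrite mulrC; move: a ap; apply: (ideal_powS_min hJ) => a c Ia cp.
by rewrite mulrC -mulrA; apply: ideal_powMS => //; apply: IH.
Qed.

Lemma ideal_pow_leq p q r : (p <= q)%N -> r \in Ipow q -> r \in Ipow p.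
Proof.
move=> lepq; rewrite -(subnKC lepq); move: r.
apply: (ideal_powD_min (submod_ideal_pow p)) => a b ap _.
by rewrite mulrC; apply: (submodZ (submod_ideal_pow p) b).
Qed.

End IdealPow.

Section Filtration.
Variables (R : comNzRingType) (I : {pred R}) (B : finType).
Local Notation V := {ffun B -> R^o}.

(** The I-adic filtration of the free module on [B]. *)
Definition adic (n : nat) (f : V) := forall b, f b \in ideal_pow I n.

Lemma submod_adic n : is_submod (adic n).
Proof.
have hn := submod_ideal_pow I n; split=> [b|a f g fn gn b]; rewrite !ffunE.
  exact: (submod0 hn).
exact: hn.2.
Qed.

Lemma adic_leq p q f : (p <= q)%N -> adic q f -> adic p f.
Proof. by move=> lepq fq b; apply: ideal_pow_leq (fq b). Qed.

Lemma adicZ p q a f : a \in ideal_pow I p -> adic q f -> adic (p + q) (a *: f).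
Proof. by move=> ap fq b; rewrite ffunE; apply: ideal_powM. Qed.

End Filtration.

Section ArtinRees.
Variables (R : comNzRingType) (hR : noetherian R) (I : {pred R}) (B : finType).
Hypothesis hI : is_submod (fun r : R^o => r \in I).
Local Notation Ipow := (ideal_pow I).
Local Notation V := {ffun B -> R^o}.
Local Notation Vt := {ffun B -> {poly R}}.

Section Rees.
Variable s : seq R.
Hypothesis Is : forall a, a \in s -> a \in I.
Hypothesis gen_s : forall r, r \in I ->
  exists c : nat -> R, r = \sum_(i < size s) c i * s`_i.

Definition rees_op (i : nat) (f : Vt) : Vt := [ffun b => s`_i *: ('X * f b)].

Definition mono (n : nat) (f : V) : Vt := [ffun b => f b *: 'X^n].

Lemma rees_op_lin i : linear (rees_op i).
Proof.
move=> a f g; apply/ffunP => b; rewrite !ffunE mulrDr scalerDr.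
by rewrite -scalerAr !scalerA mulrC.
Qed.

Lemma rees_opC i j f : rees_op i (rees_op j f) = rees_op j (rees_op i f).
Proof.
by apply/ffunP => b; rewrite !ffunE -!scalerAr !scalerA mulrC.
Qed.

Lemma mono_lin n : linear (mono n).
Proof. by move=> a f g; apply/ffunP => b; rewrite !ffunE scalerDl scalerA. Qed.

Lemma mono_rees n i f : mono n.+1 (s`_i *: f) = rees_op i (mono n f).
Proof. by apply/ffunP => b; rewrite !ffunE -scalerAr scalerA -exprS. Qed.

(** The submodules generated from degree 0 by the first r operators; the last
    one is the Rees module, whose part of degree n is the n-th adic piece. *)
Fixpoint rees (r : nat) : Vt -> Prop :=
  if r is r'.+1 then poly_over rees_op r' (rees r')
  else fun v => exists2 f, True & mono 0 f = v.

Lemma noeth_rees r : stable rees_op r (rees r) /\ noeth rees_op r (rees r).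
Proof.
elim: r => [|r [stW nW]] /=.
  have smT : is_submod (fun _ : V => True) by [].
  split; first by apply/stable0; apply: is_submod_im => //; apply: mono_lin.
  apply: (@noeth_im _ _ _ (fun=> id) _ _ (@mono_lin 0) _ smT).
  exact: noeth_free.
split; first exact: (stable_poly_over rees_op_lin rees_opC).
exact: (hilbert_basis rees_op_lin rees_opC stW nW).
Qed.

Lemma mono0_rees r f : rees r (mono 0 f).
Proof.
elim: r => [|r IH] /=; first by exists f.
exact: poly_over_base.
Qed.

(** I ^ n is spanned by the products of n generators of I, and multiplication by
    a generator is one of the operators, up to the shift of degree. *)
Lemma adic_rees n f : adic I n f -> rees (size s) (mono n f).
Proof.
have [[smW WU] _] := noeth_rees (size s) => fn.
suff H r : r \in Ipow n -> forall g, rees (size s) (mono n (r *: g)).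
  have -> : f = \sum_b f b *: [ffun c => (c == b)%:R].
    apply/ffunP => c; rewrite sum_ffunE (bigD1 c) //= big1 => [|b nbc].
      by rewrite !ffunE eqxx addr0 [_ *: _]mulr1.
    by rewrite !ffunE eq_sym (negPf nbc) scaler0.
  apply: (submod_sum (is_submod_preim (@mono_lin n) smW)) => b _.
  exact: H.
elim: n r {f fn} => [|n IH] r; first by move=> _ g; apply: mono0_rees.
move=> rn g; have lin1 : linear (fun r : R^o => r *: g : V).
  by move=> a u v; rewrite scalerDl scalerA.
have smJ := is_submod_preim lin1 (is_submod_preim (@mono_lin n.+1) smW).
move: r rn; apply: (ideal_powS_min smJ).
move=> a b /gen_s[c ->] bn.
rewrite mulr_suml scaler_suml; apply: (submod_sum (is_submod_preim (@mono_lin _) smW)).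
move=> i _; rewrite -mulrA mulrCA -scalerA mono_rees; apply: WU => //.
by rewrite mulrC -scalerA; apply: IH.
Qed.

Definition coefs (n : nat) (f : Vt) : V := [ffun b => (f b)`_n].

Lemma coefs_lin n : linear (coefs n).
Proof. by move=> a f g; apply/ffunP => b; rewrite !ffunE coefD coefZ. Qed.

Lemma coefs_mono k n f : coefs k (mono n f) = if k == n then f else 0.
Proof.
apply/ffunP => b; rewrite !ffunE coefZ coefXn.
by case: eqP => _; rewrite ?ffunE (mulr1, mulr0).
Qed.

Lemma coefs_rees_op n i f :
  coefs n (rees_op i f) = if n is n'.+1 then s`_i *: coefs n' f else 0.
Proof.
apply/ffunP => b; rewrite !ffunE coefZ coefXM.
by case: n => [|n]; rewrite !ffunE ?mulr0.
Qed.

End Rees.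

(** The submodule I ^ n L, as the intersection of the submodules that contain
    its generators. *)
Definition adic_mul (n : nat) (L : V -> Prop) (f : V) :=
  forall N, is_submod N -> (forall p g, p \in Ipow n -> L g -> N (p *: g)) -> N f.

Lemma submod_adic_mul n L : is_submod (adic_mul n L).
Proof.
split=> [N [N0 _] //|a f g fL gL N hN NL].
by apply: hN.2; [apply: fL | apply: gL].
Qed.

(** The graded module with component [L] /\ [adic n] in degree n is a
    submodule of the Rees module, so it has finitely many generators; c bounds
    their degrees, and an element of degree n is a combination of them whose
    coefficients have degree at least n - c. *)
Lemma artin_rees (L : V -> Prop) : is_submod L ->
  exists c, forall n f, L f -> adic I n f -> adic_mul (n - c) L f.
Proof.
move=> hL; have [s [Is gen_s]] := ideal_gens hR hI.
have [stW nW] := noeth_rees s (size s).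
(* L /\ adic n in degree n, as polynomials; L enters coefficientwise. *)
pose Lt f := rees s (size s) f /\ forall n, L (coefs n f).
have Ipow0 n : (0 : R) \in Ipow n := submod0 (submod_ideal_pow I n).
have stLt : stable (rees_op s) (size s) Lt.
  split; first split.
  - split=> [|n]; first exact: submod0 stW.1.
    by rewrite (lin_map0 (@coefs_lin n)); apply: submod0.
  - move=> a u v [Wu Lu] [Wv Lv]; split=> [|n]; first exact: stW.1.2.
    by rewrite coefs_lin; apply: hL.2.
  - move=> i lti v [Wv Lv]; split=> [|[|n]]; first exact: stW.2.
      by rewrite coefs_rees_op; apply: submod0.
    by rewrite coefs_rees_op; apply: submodZ.
have [|t [ht gens]] := nW _ stLt; first by move=> v [].
pose c := (\max_(f <- t) \max_b size (f b))%N.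
exists c => n f Lf fn.
(* The truncated k - c makes the condition on M harmless in degrees up to c. *)
pose M g := forall k, adic_mul (k - c) L (coefs k g).
have smM : is_submod M.
  split=> [k|a u v Mu Mv k]; rewrite ?(lin_map0 (@coefs_lin k)) ?coefs_lin.
    exact: submod0 (submod_adic_mul _ _).
  by apply: (submod_adic_mul _ _).2.
have hf : Lt (mono n f).
  split=> [|k]; first exact: adic_rees.
  by rewrite coefs_mono; case: eqP => // _; apply: submod0.
suff : M (mono n f) by move/(_ n); rewrite coefs_mono eqxx.
apply: (gens M) => //.
  split=> // i lti v Mv [|k]; rewrite coefs_rees_op.
    exact: submod0 (submod_adic_mul _ _).
  have Isi : s`_i \in I by apply: Is; apply: mem_nth.
  move=> N hN hNL; apply: (Mv k (fun w => N (s`_i *: w))).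
    by apply: is_submod_preim hN => a u w; rewrite scalerDr !scalerA mulrC.
  move=> p g pk Lg; rewrite scalerA; apply: hNL => //.
  by apply: ideal_pow_leq (ideal_powMS Isi pk); lia.
move=> g gt k; have [lekc|ltck] := leqP k c.
  move=> N hN NL; rewrite -[coefs k g]scale1r.
  by apply: NL; [move/eqP: lekc => -> | apply: (ht g gt).2].
suff -> : coefs k g = 0 by apply: submod0 (submod_adic_mul _ _).
apply/ffunP => b; rewrite !ffunE nth_default //; apply: leq_trans (ltnW ltck).
rewrite /c (big_rem g) //=; apply: leq_trans (leq_maxl _ _).
exact: (leq_bigmax (F := fun b => size (g b)) b).
Qed.

End ArtinRees.

(** * Representatives in a subquotient *)

Section Representatives.
Variables (R : comNzRingType) (V : lmodType R) (A B : submodClosed V).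
Local Notation Q := (Quotient.quot (submod_pred (@sub_preim R V A B))).
Local Open Scope quotient_scope.

Definition represents (v : subquot A B) (z : V) : Prop :=
  exists hz : z \in A, v = \pi_Q (exist _ z hz : submod_type A).

Lemma represents_ex v : exists2 z, z \in A & represents v z.
Proof.
have hz := valP (repr (v : Q)); exists (val (repr (v : Q))) => //.
exists hz; rewrite -[LHS](@reprK _ Q); congr (\pi_Q _).
exact: val_inj.
Qed.

Lemma ex_represents z : z \in A -> exists v, represents v z.
Proof. by move=> hz; exists (\pi_Q (exist _ z hz : submod_type A)), hz. Qed.

Lemma represents_lin a u v y z :
  represents u y -> represents v z -> represents (a *: u + v) (a *: y + z).
Proof.
move=> [hy ->] [hz ->].
have h : a *: y + z \in A by rewrite rpredD ?rpredZ.
exists h; rewrite -[_ *: _]/(quot_scale a _) quot_scaleE.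
rewrite -[LHS](raddfD (\pi_Q : submod_type A -> Q)); congr (\pi_Q _).
exact: val_inj.
Qed.

Lemma represents0 v z : represents v z -> (v = 0) <-> (z \in B).
Proof.
move=> [hz ->]; set x : submod_type A := exist _ z hz.
have -> : (z \in B) = (x - 0 \in submod_pred (@sub_preim R V A B)).
  by rewrite subr0 -[RHS]/(val x \in B).
rewrite Quotient.idealrBE; split=> [h|/eqP h].
  by apply/eqP; rewrite [LHS]h; symmetry; exact: (raddf0 (\pi_Q : submod_type A -> Q)).
by rewrite [LHS]h; exact: (raddf0 (\pi_Q : submod_type A -> Q)).
Qed.

End Representatives.

Section Length.
Variable R : comNzRingType.

(** A linear relation that is total on V and injective carries strict chains of
    submodules of V to strict chains in W.  When it is such in both directions it
    replaces an isomorphism in the comparison of lengths. *)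
Definition correspondence (V W : lmodType R) (rel : V -> W -> Prop) :=
  [/\ forall a v v' w w', rel v w -> rel v' w' -> rel (a *: v + v') (a *: w + w'),
      forall v, exists w, rel v w & forall v, rel v 0 -> v = 0].

Lemma no_chain_corr (V W : lmodType R) (rel : V -> W -> Prop) n :
  rel 0 0 -> correspondence rel -> no_chain W n -> no_chain V n.
Proof.
move=> rel0 [relP relV inj] /asboolP nW; apply/asboolP => -[C hC]; apply: nW.
have smD k : is_submod (fun w => exists v, v \in C k /\ rel v w).
  split=> [|a w w' [v [Cv vw]] [v' [Cv' vw']]]; first by exists 0; rewrite rpred0.
  by exists (a *: v + v'); rewrite rpredD ?rpredZ //; split=> //; apply: relP.
exists (fun k => prop_submod (smD k) : submodClosed W) => k ltkn.
have [sub [v Cv nCv]] := hC k ltkn.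
split=> [w|].
  by rewrite !inE => /asboolP[u [Cu uw]]; apply/asboolP; exists u; split=> //; apply: sub.
have [w vw] := relV v; exists w; rewrite !inE; first by apply/asboolP; exists v.
apply/negP => /asboolP[u [Cu uw]]; move/negP: nCv; apply.
have := relP (-1) _ _ _ _ uw vw; rewrite !scaleN1r addNr => /inj/eqP.
by rewrite addrC subr_eq0 => /eqP->.
Qed.

Lemma mlength_corr (V W : lmodType R) (rel : V -> W -> Prop) :
  correspondence rel -> correspondence (fun w v => rel v w) -> mlength V = mlength W.
Proof.
move=> hV hW; have rel0 : rel 0 0.
  by have [_ /(_ 0)[w r0w] _] := hV; have [_ _ /(_ _ r0w) w0] := hW; rewrite w0 in r0w.
have E : no_chain V = no_chain W.
  apply/funext => n; apply/idP/idP; first exact: (no_chain_corr rel0 hW).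
  exact: (no_chain_corr rel0 hV).
by rewrite /mlength E.
Qed.

End Length.

(** * Prime ideals, nilpotence and Krull's intersection theorem *)

Section PropPrime.
Variables (R : comNzRingType) (J : R^o -> Prop).

Definition proper_prop (J : R^o -> Prop) := is_submod J /\ ~ J 1.
Definition prime_prop (J : R^o -> Prop) :=
  proper_prop J /\ forall u v : R, J (u * v) -> J u \/ J v.

Definition prop_proper of proper_prop J : {pred R} := [pred r | `[< J r >]].
Definition prop_prime of prime_prop J : {pred R} := [pred r | `[< J r >]].

Lemma prop_idealr_closed : proper_prop J -> idealr_closed [pred r : R | `[< J r >]].
Proof.
move=> [[J0 JP] J1]; split=> [||a u v]; rewrite !inE; first exact/asboolP.
  by apply/negP => /asboolP.
by move=> /asboolP Ju /asboolP Jv; apply/asboolP; apply: JP.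
Qed.

Fact prop_prime_closed (hJ : prime_prop J) : prime_idealr_closed (prop_prime hJ).
Proof.
move=> u v; rewrite !inE => /asboolP/hJ.2[] h; apply/orP; [left|right];
exact/asboolP.
Qed.

HB.instance Definition _ hJ := isIdealr.Build R (prop_proper hJ) (prop_idealr_closed hJ).
HB.instance Definition _ (hJ : prime_prop J) :=
  isIdealr.Build R (prop_prime hJ) (prop_idealr_closed hJ.1).
HB.instance Definition _ hJ :=
  isPrimeIdealrClosed.Build R (prop_prime hJ) (@prop_prime_closed hJ).
End PropPrime.

Section IdealScale.
Variables (R : comNzRingType) (K : R^o -> Prop) (hK : is_submod K).

Lemma submodM (c r : R) : K r -> K (c * r).
Proof. exact: submodZ hK c r. Qed.

Lemma submodMr (c r : R) : K r -> K (r * c).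
Proof. by rewrite mulrC; apply: submodM. Qed.

End IdealScale.

Section IdealPlus.
Variables (R : comNzRingType) (K : R^o -> Prop) (hK : is_submod K) (a : R).

(** The ideal K + (a). *)
Definition ideal_plus (r : R^o) := exists c : R, K (r - c * a).

Lemma submod_ideal_plus : is_submod ideal_plus.
Proof.
split=> [|b u v [c hu] [d hv]]; first by exists 0; rewrite mul0r subr0; apply: submod0.
exists (b * c + d).
suff -> : b *: u + v - (b * c + d) * a = b *: (u - c * a) + (v - d * a) by apply: hK.2.
by rewrite scalerBr mulrDl opprD addrACA -mulrA.
Qed.

Lemma ideal_plus_sub r : K r -> ideal_plus r.
Proof. by exists 0; rewrite mul0r subr0. Qed.

Lemma ideal_plus_gen : ideal_plus a.
Proof. by exists 1; rewrite mul1r subrr; apply: submod0. Qed.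

End IdealPlus.

Section Noetherian.
Variables (R : comNzRingType) (hR : noetherian R).

(** Without a maximal element there would be a strictly increasing sequence of
    ideals, whose union could not be finitely generated. *)
Lemma acc_max (C : (R^o -> Prop) -> Prop) (J : R^o -> Prop) :
  (forall P, C P -> is_submod P) -> C J ->
  exists P, [/\ C P, forall r, J r -> P r &
    forall Q, C Q -> (forall r, P r -> Q r) -> forall r, Q r -> P r].
Proof.
move=> CS CJ; apply: contrapT => noMax.
pose T := {P | C P /\ forall r, J r -> P r}.
have step (P : T) : exists Q : T, (forall r, sval P r -> sval Q r) /\
    exists r, sval Q r /\ ~ sval P r.
  apply: contrapT => hP; apply: noMax; exists (sval P).
  have [CP JP] := svalP P; split=> // Q CQ PQ r Qr; apply: contrapT => nPr.
  apply: hP; exists (exist _ Q (conj CQ (fun r Jr => PQ r (JP r Jr)))).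
  by split=> //; exists r.
have [f hf] := choice step.
pose S n := sval (iter n f (exist _ J (conj CJ (fun r Jr => Jr)))).
have smS n : is_submod (S n).
  by apply: CS; have [] := svalP (iter n f (exist _ J (conj CJ (fun r Jr => Jr)))).
have S_leq m n r : (m <= n)%N -> S m r -> S n r.
  by move/subnK <-; elim: (n - m)%N => //= k IH /IH Sr; apply: (hf _).1.
have smU : is_submod (fun r => exists n, S n r).
  split; first by exists 0%N; apply: submod0.
  move=> a u v [m hu] [n hv]; exists (maxn m n); apply: (smS _).2;
    [apply: S_leq hu | apply: S_leq hv]; by rewrite (leq_maxl, leq_maxr).
have [s [Us gen]] := ideal_gens hR smU.
have [n Sn] : exists n, forall a, a \in s -> S n a.
  elim: s Us {gen} => [|a s IH] hs; first by exists 0%N.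
  have [|d hd] := IH; first by move=> u us; apply: hs; rewrite inE us orbT.
  have [n hw] := hs a (mem_head _ _); exists (maxn n d) => u.
  by rewrite inE => /predU1P[->|/hd hu];
    [apply: S_leq hw | apply: S_leq hu]; rewrite (leq_maxl, leq_maxr).
have [_ [r [Sr nSr]]] := hf (iter n f (exist _ J (conj CJ (fun r Jr => Jr)))).
apply: nSr; have [|c ->] := gen r; first by exists n.+1.
apply: (submod_sum (smS n)) => i _.
by apply: (submodM (smS n)); apply: Sn; apply: mem_nth.
Qed.

(** For a = 1 this is a maximal ideal above J, for general a a prime ideal that
    does not contain a. *)
Lemma avoiding_max (J : R^o -> Prop) (a : R) : is_submod J ->
  (forall n, ~ J (a ^+ n)) ->
  exists P : R^o -> Prop, [/\ is_submod P, forall n, ~ P (a ^+ n), forall r, J r -> P r &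
    forall Q : R^o -> Prop, is_submod Q -> (forall n, ~ Q (a ^+ n)) ->
      (forall r, P r -> Q r) -> forall r, Q r -> P r].
Proof.
move=> smJ Ja.
have [||P [[smP Pa] JP maxP]] :=
  @acc_max (fun P : R^o -> Prop => is_submod P /\ forall n, ~ P (a ^+ n)) J _ _ => //.
  by move=> P [].
by exists P; split=> // Q smQ Qa; apply: maxP.
Qed.

Lemma avoiding_prime (J : R^o -> Prop) (a : R) : is_submod J ->
  (forall n, ~ J (a ^+ n)) ->
  exists P : R^o -> Prop, [/\ prime_prop P, ~ P a & forall r, J r -> P r].
Proof.
move=> smJ /(avoiding_max smJ)[P [smP Pa JP maxP]]; exists P; split=> //; last first.
  by have := Pa 1%N; rewrite expr1.
split=> [|u v Puv]; first by split=> //; have := Pa 0%N; rewrite expr0.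
apply: contrapT => /not_orP[nPu nPv].
have meets w : ~ P w -> exists n, ideal_plus P w (a ^+ n).
  move=> nPw; apply: contrapT => hw; apply: nPw.
  apply: (maxP _ (submod_ideal_plus smP w)).
  - by move=> n hn; apply: hw; exists n.
  - by move=> r; apply: ideal_plus_sub.
  - exact: ideal_plus_gen.
have [[n [c hc]] [k [d hd]]] := (meets u nPu, meets v nPv).
apply: (Pa (n + k)%N); rewrite exprD -(subrK (c * u) (a ^+ n)) mulrDl.
apply: (submodD smP); first exact: submodMr.
rewrite -(subrK (d * v) (a ^+ k)) mulrDr; apply: (submodD smP); first exact: submodM.
by rewrite mulrACA; apply: (submodM smP).
Qed.

Variable m : idealr R.

Lemma idealr_submod : is_submod (fun r : R^o => r \in m).
Proof.
split=> [|a u v um vm]; first exact: idealr0.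
by rewrite rpredD // -[a *: u]/(a * u) idealMr.
Qed.

(** Otherwise a maximal ideal, hence m, would contain both 1 - a and a. *)
Lemma local_inv (hm : local_ring m) a : a \in m -> exists b, b * (1 - a) = 1.
Proof.
move=> am; apply: contrapT => ninv.
have sm0 : is_submod (fun r : R^o => r = 0).
  by split=> // b u v -> ->; rewrite scaler0 addr0.
have [|P [smP P1 JP maxP]] := avoiding_max (a := 1) (submod_ideal_plus sm0 (1 - a)).
  by move=> n; rewrite expr1n => -[c /subr0_eq hc]; apply: ninv; exists c.
have hP : proper_prop P by split=> //; have := P1 0%N; rewrite expr0.
have Pm : maximal_ideal (prop_proper hP).
  move=> Q PQ r; rewrite inE; apply/idP/asboolP => [Qr|Pr]; last first.
    by apply: PQ; rewrite inE; apply/asboolP.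
  apply: (maxP (fun r => r \in Q)) => //.
  - split=> [|b u v uQ vQ]; first exact: idealr0.
    by rewrite rpredD // -[b *: u]/(b * u) idealMr.
  - by move=> n; rewrite expr1n => h; rewrite idealr1 in h.
  - by move=> u Pu; apply: PQ; rewrite inE; apply/asboolP.
have Pa : P (1 - a) by apply: JP; apply: ideal_plus_gen.
have : 1 - a \in m by rewrite -(hm.2 _ Pm) inE; apply/asboolP.
by move=> h; have := rpredD h am; rewrite subrK idealr1.
Qed.

Lemma ideal_pow1 r : r \in ideal_pow m 1 -> r \in m.
Proof.
apply: (ideal_powS_min idealr_submod) => a b am _.
by rewrite mulrC idealMr.
Qed.

(** In (K + (a)) ^ n all products lie in K except the multiples of a ^ n. *)
Lemma ideal_plus_pow (K : R^o -> Prop) (a : R) p n : is_submod K ->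
  (forall r, r \in ideal_pow m p -> ideal_plus K a r) -> K (a ^+ n) ->
  forall r, r \in ideal_pow m (n * p) -> K r.
Proof.
move=> smK hp Kan.
have H j r : r \in ideal_pow m (j * p) -> ideal_plus K (a ^+ j) r.
  have smj j' := submod_ideal_plus smK (a ^+ j').
  elim: j r => [|j IH] r.
    by move=> _; exists r; rewrite mulr1 subrr; apply: submod0.
  rewrite mulSn; move: r; apply: (ideal_powD_min (smj _)) => u v /hp[c hc] /IH[d hd].
  exists (c * d); rewrite exprS mulrACA.
  rewrite -(subrK (u * (d * a ^+ j)) (u * v)) -mulrBr -addrA -mulrBl.
  by apply: (submodD smK); [apply: (submodM smK) | apply: (submodMr smK)].
move=> r /H[c hc]; rewrite -(subrK (c * a ^+ n) r).
by apply: (submodD smK); [apply: hc | apply: (submodM smK)].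
Qed.

(** The generators of m are adjoined to J one at a time: m itself lies in the
    last ideal obtained, and [ideal_plus_pow] goes back down to J. *)
Lemma pow_sub_of_nil (J : R^o -> Prop) : is_submod J ->
  (forall a, a \in m -> exists n, J (a ^+ n)) ->
  exists n, forall r, r \in ideal_pow m n -> J r.
Proof.
move=> smJ nil; have [s [ms gen]] := ideal_gens hR idealr_submod.
have H (K : R^o -> Prop) : is_submod K -> (forall r, J r -> K r) ->
    (forall M, is_submod M -> (forall r, K r -> M r) -> (forall a, a \in s -> M a) ->
      forall r, r \in m -> M r) ->
    exists n, forall r, r \in ideal_pow m n -> K r.
  elim: s ms {gen} K => [|a s IH] ms K smK JK gen.
    by exists 1%N => r /ideal_pow1; apply: (gen K).
  have [n Jan] := nil a (ms a (mem_head _ _)).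
  have [||r /JK Kr|M smM KM Ms|p hp] := IH _ (ideal_plus K a).
  - by move=> u us; apply: ms; rewrite inE us orbT.
  - exact: submod_ideal_plus.
  - exact: ideal_plus_sub.
  - apply: gen => // [r Kr|u]; first by apply: KM; apply: ideal_plus_sub.
    by rewrite inE => /predU1P[->|/Ms //]; apply: KM; apply: ideal_plus_gen.
  by exists (n * p)%N; apply: ideal_plus_pow (JK _ Jan).
apply: H => // M smM _ Ms r /gen[c ->]; apply: (submod_sum smM) => i _.
by apply: (submodM smM); apply: Ms; apply: mem_nth.
Qed.

Lemma pow_sub_of_primes (J : R^o -> Prop) : is_submod J ->
  (forall p : prime_idealr R, (forall r, J r -> r \in p) -> p =i m) ->
  exists n, forall r, r \in ideal_pow m n -> J r.
Proof.
move=> smJ hJ; apply: pow_sub_of_nil => // a am; apply: contrapT => hn.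
have [|P [hP nPa JP]] := avoiding_prime (a := a) smJ.
  by move=> n Jn; apply: hn; exists n.
apply: nPa; have := hJ (prop_prime hP) _ a; rewrite am inE => h.
by apply/asboolP; rewrite h // => r /JP Pr; rewrite inE; apply/asboolP.
Qed.

(** The primes containing the annihilator of a class in (I : x) / I lie in the
    support of that module, so m is the only one and a power of m lies in the
    annihilator; finitely many classes generate. *)
Lemma colon_pow (I : submodClosed R^o) (x : R) :
  (forall p, in_supp (subquot (colon I x) I) p -> p =i m) ->
  exists n, forall a u, a \in ideal_pow m n -> u * x \in I -> a * u \in I.
Proof.
move=> hsupp.
have smI : is_submod (fun r : R^o => r \in I).
  by split=> [|a u v uI vI]; rewrite ?rpred0 // rpredD // rpredZ.
have smann (u : R) : is_submod (fun r : R^o => r * u \in I).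
  apply: eq_submod (submod_mulr u smI) => r; by rewrite mulrC.
have smcolon : is_submod (fun u : R^o => u * x \in I).
  by apply: eq_submod (submod_mulr x smI) => r; rewrite mulrC.
have ann u : u * x \in I -> exists n, forall r, r \in ideal_pow m n -> r * u \in I.
  move=> uI; apply: (pow_sub_of_primes (smann u)) => p hp; apply: hsupp.
  have [|u0 hu0] := @ex_represents _ _ (colon I x) I u; first by rewrite inE.
  exists (u0, 1); first by rewrite idealr1.
  case=> t tp; rewrite /= scale1r scaler0 subr0 => t0.
  have h0 : represents (B := I) (0 : subquot (colon I x) I) 0.
    by have := represents_lin (-1) hu0 hu0; rewrite !scaleN1r !addNr.
  have := represents_lin t hu0 h0; rewrite !addr0 => /represents0[/(_ t0) tI _].
  by move/negP: tp; apply; apply: hp.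
have [s [cs gen]] := ideal_gens hR smcolon.
suff [n hn] : exists n, forall g, g \in s -> forall a, a \in ideal_pow m n -> a * g \in I.
  exists n => a u an /gen[c ->]; rewrite mulr_sumr; apply: (submod_sum smI) => i _.
  by rewrite mulrCA; apply: (submodM smI); apply: hn => //; apply: mem_nth.
elim: s cs {gen} => [|g s IH] cs; first by exists 0%N.
have [|n hn] := IH; first by move=> u us; apply: cs; rewrite inE us orbT.
have [k hk] := ann g (cs g (mem_head _ _)).
exists (maxn n k) => h; rewrite inE => /predU1P[->|hs] a ha.
  by apply: hk; apply: ideal_pow_leq ha; apply: leq_maxr.
by apply: hn => //; apply: ideal_pow_leq ha; apply: leq_maxl.
Qed.

Variable B : finType.
Local Notation V := {ffun B -> R^o}.

(** The generators of L' are eliminated one at a time: if v = l + a v + w with l in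
    L, a in m and w in the span of the other generators, then 1 - a is
    invertible and v is redundant. *)
Lemma nakayama (hm : local_ring m) (L L' : V -> Prop) :
  is_submod L -> is_submod L' ->
  (forall f, L' f -> exists2 l, L l & adic_mul m 1 L' (f - l)) ->
  forall f, L' f -> L f.
Proof.
move=> smL smL' hL'.
have [s [L's gen]] := noeth_free hR (U := fun=> id) ((stable0 _ L').2 smL') (fun _ _ => I).
have {gen} : forall N, is_submod N -> (forall f, L f -> N f) ->
    (forall g, g \in s -> N g) -> forall f, L' f -> N f.
  by move=> N smN _; apply: gen; apply/stable0.
elim: s L's => [|v s IH] L's gen; first exact: gen.
apply: IH => [g gs|N smN LN Ns f L'f]; first by apply: L's; rewrite inE gs orbT.
suff Nv : N v by apply: gen f L'f => // g; rewrite inE => /predU1P[-> //|/Ns].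
have [l Ll hl] := hL' v (L's v (mem_head _ _)).
have modv g : L' g -> exists c : R, N (g - c *: v).
  apply: (gen (fun g => exists c : R, N (g - c *: v))).
  - split=> [|a u w [c hc] [d hd]].
      by exists 0; rewrite scale0r subr0; apply: submod0.
    exists (a * c + d).
    by rewrite scalerDl opprD addrACA -scalerA -scalerBr; apply: smN.2.
  - by move=> h Lh; exists 0; rewrite scale0r subr0; apply: LN.
  - move=> h; rewrite inE => /predU1P[->|/Ns Nh].
      by exists 1; rewrite scale1r subrr; apply: submod0.
    by exists 0; rewrite scale0r subr0.
have [|p g pm /modv[c hc]|a am ha] := hl (fun w => exists2 a, a \in m & N (w - a *: v)).
- have [m0 mP] := idealr_submod.
  split=> [|a u w [c cm hc] [d dm hd]].
    by exists 0 => //; rewrite scale0r subr0; apply: submod0.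
  exists (a * c + d); first exact: mP.
  by rewrite scalerDl opprD addrACA -scalerA -scalerBr; apply: smN.2.
- exists (p * c); first by rewrite mulrC idealMr // ideal_pow1.
  by rewrite -scalerA -scalerBr; apply: submodZ.
have [b hb] := local_inv hm am.
rewrite -[v]scale1r -hb -scalerA; apply: submodZ => //.
rewrite scalerBl scale1r -(subrK l (v - _)); apply: submodD => //; last exact: LN.
by rewrite addrAC.
Qed.

(** Krull's intersection theorem.  For the closure L' of L, the Artin-Rees lemma
    gives L' = L + m L', and Nakayama's lemma gives L' = L. *)
Lemma krull (hm : local_ring m) (L : V -> Prop) (f : V) : is_submod L ->
  (forall n, exists2 l, L l & adic m n (f - l)) -> L f.
Proof.
move=> smL hf; pose L' (g : V) := forall n, exists2 l, L l & adic m n (g - l).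
have smA n : is_submod (adic m n : V -> Prop) := @submod_adic R m B n.
have smL' : is_submod L'.
  split=> [n|a u v hu hv n].
    by exists 0; [apply: submod0 | rewrite subr0; apply: submod0].
  have [[k Lk hk] [l Ll hl]] := (hu n, hv n).
  exists (a *: k + l); first exact: smL.2.
  by rewrite opprD addrACA -scalerBr; apply: (smA n).2.
have LL' l : L l -> L' l by exists l; rewrite // subrr; apply: submod0.
have [c hc] := artin_rees hR idealr_submod smL'.
apply: (nakayama hm smL smL') hf => g L'g; have [l Ll hl] := L'g c.+1.
exists l => //; have := hc c.+1 (g - l) (submodB smL' L'g (LL' l Ll)) hl.
by rewrite subSnn.
Qed.

End Noetherian.

(** * The Koszul complex as a family of differentials on one module *)

(** The type [koszul l] depends on the entries of l, so the chains of the Koszul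
    complexes of two sequences of the same length have different types.  Here
    the basis is made to depend on the length only: all differentials act on
    the same module [kmod s], where they can be subtracted. *)
Section KoszulModel.
Variable R : comNzRingType.

Fixpoint kbasis (s : nat) : finType :=
  if s is s'.+1 then (bool * kbasis s')%type : finType else unit.

Fixpoint kdeg (s : nat) : kbasis s -> nat :=
  if s is s'.+1 return kbasis s -> nat then
    fun b : bool * kbasis s' => (nat_of_bool b.1 + kdeg b.2)%N
  else fun=> 0%N.

Fixpoint kcoef (s : nat) (x : nat -> R) : kbasis s -> kbasis s -> R :=
  if s is s'.+1 return kbasis s -> kbasis s -> R then
    fun b c : bool * kbasis s' =>
      kdiff (x 0%N) b.1 c.1 *+ (b.2 == c.2) +
      (-1) ^+ nat_of_bool b.1 * kcoef (x \o S) b.2 c.2 *+ (b.1 == c.1)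
  else fun _ _ => 0.

Lemma kcoef_cpx s (x : nat -> R) :
  (forall b c : kbasis s, kcoef x b c != 0 -> kdeg b = (kdeg c).+1) /\
  (forall b c : kbasis s, \sum_e kcoef x b e * kcoef x e c = 0).
Proof.
elim: s x => [|s IH] x.
  by split=> [b c|b c]; rewrite ?eqxx // big1 // => e _; rewrite mul0r.
have [hd hs] := IH (x \o S).
pose T := tensor (koszul1 (x 0%N)) (FreeCpx hd hs).
by split; [exact: (cdiff_deg T) | exact: (cdiff_sq T)].
Qed.

Definition kos s (x : nat -> R) : freeCpx R :=
  FreeCpx (kcoef_cpx s x).1 (kcoef_cpx s x).2.

Lemma freeCpx_irr (B : finType) deg (diff : B -> B -> R) p p' q q' :
  @FreeCpx R B deg diff p q = @FreeCpx R B deg diff p' q'.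
Proof. by rewrite (Prop_irrelevance p p') (Prop_irrelevance q q'). Qed.

Lemma koszulE (l : seq R) : koszul l = kos (size l) (nth 0 l).
Proof.
elim: l => [|a l IH]; first exact: freeCpx_irr.
rewrite -[LHS]/(tensor (koszul1 a) (koszul l)) IH; exact: freeCpx_irr.
Qed.

Definition kmod s := {ffun kbasis s -> R^o}.
HB.instance Definition _ s := GRing.Lmodule.on (kmod s).

Definition kpart s (b : bool) (f : kmod s.+1) : kmod s := [ffun c => f (b, c)].

(** The form f0 + e_0 f1. *)
Definition kpair s (f0 f1 : kmod s) : kmod s.+1 :=
  [ffun p : bool * kbasis s => if p.1 then f1 p.2 else f0 p.2].

(** Contraction with the j-th dual basis vector. *)
Fixpoint contr s (j : nat) : kmod s -> kmod s :=
  match s return kmod s -> kmod s with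
  | 0 => fun=> 0
  | s'.+1 => fun f =>
    if j is j'.+1 then kpair (contr j' (kpart false f)) (- contr j' (kpart true f))
    else kpair (kpart true f) 0
  end.

(** Exterior multiplication by the j-th basis vector. *)
Fixpoint wedge s (j : nat) : kmod s -> kmod s :=
  match s return kmod s -> kmod s with
  | 0 => fun=> 0
  | s'.+1 => fun f =>
    if j is j'.+1 then kpair (wedge j' (kpart false f)) (- wedge j' (kpart true f))
    else kpair 0 (kpart false f)
  end.

Lemma kpart_pair s b (f0 f1 : kmod s) : kpart b (kpair f0 f1) = if b then f1 else f0.
Proof. by apply/ffunP => c; rewrite !ffunE; case: b. Qed.

Lemma kpairE s (f : kmod s.+1) : f = kpair (kpart false f) (kpart true f).
Proof. by apply/ffunP => -[[] c]; rewrite !ffunE. Qed.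

Lemma kpart_lin s b : linear (@kpart s b).
Proof. by move=> a f g; apply/ffunP => c; rewrite !ffunE. Qed.
HB.instance Definition _ s b :=
  GRing.isLinear.Build R (kmod s.+1) (kmod s) *:%R (@kpart s b) (@kpart_lin s b).

Lemma kpair_lin s a (f0 f1 g0 g1 : kmod s) :
  a *: kpair f0 f1 + kpair g0 g1 = kpair (a *: f0 + g0) (a *: f1 + g1).
Proof. by apply/ffunP => -[[] c]; rewrite !ffunE. Qed.

Lemma kpairD s (f0 f1 g0 g1 : kmod s) :
  kpair f0 f1 + kpair g0 g1 = kpair (f0 + g0) (f1 + g1).
Proof. by apply/ffunP => -[[] c]; rewrite !ffunE. Qed.

Lemma kpairN s (f0 f1 : kmod s) : - kpair f0 f1 = kpair (- f0) (- f1).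
Proof. by apply/ffunP => -[[] c]; rewrite !ffunE. Qed.

Lemma kpair0 s : kpair 0 0 = 0 :> kmod s.+1.
Proof. by apply/ffunP => -[[] c]; rewrite !ffunE. Qed.

Lemma contr_lin s j : linear (@contr s j).
Proof.
elim: s j => [|s IH] [|j] a f g /=; rewrite ?scaler0 ?addr0 // kpair_lin !linearP //=.
  by rewrite scaler0 addr0.
by rewrite !IH scalerN opprD.
Qed.
HB.instance Definition _ s j :=
  GRing.isLinear.Build R (kmod s) (kmod s) *:%R (@contr s j) (@contr_lin s j).

Lemma wedge_lin s j : linear (@wedge s j).
Proof.
elim: s j => [|s IH] [|j] a f g /=; rewrite ?scaler0 ?addr0 // kpair_lin !linearP //=.
  by rewrite scaler0 addr0.
by rewrite !IH scalerN opprD.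
Qed.
HB.instance Definition _ s j :=
  GRing.isLinear.Build R (kmod s) (kmod s) *:%R (@wedge s j) (@wedge_lin s j).

Lemma contrN s j (f : kmod s) : contr j (- f) = - contr j f.
Proof. exact: raddfN. Qed.

Lemma contr0 s j : contr j 0 = 0 :> kmod s.
Proof. exact: raddf0. Qed.

Lemma contrZ s j a (f : kmod s) : contr j (a *: f) = a *: contr j f.
Proof. exact: linearZ. Qed.

Lemma wedgeN s j (f : kmod s) : wedge j (- f) = - wedge j f.
Proof. exact: raddfN. Qed.

Lemma wedge0 s j : wedge j 0 = 0 :> kmod s.
Proof. exact: raddf0. Qed.

Lemma contrC s j k (f : kmod s) : contr j (contr k f) = - contr k (contr j f).
Proof.
elim: s j k f => [|s IH] [|j] [|k] f /=; rewrite ?oppr0 //.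
all: rewrite !kpart_pair kpairN ?contr0 ?wedge0 ?oppr0 ?opprK //.
by congr kpair; rewrite ?contrN ?opprK IH.
Qed.

Lemma contr_sq s j (f : kmod s) : contr j (contr j f) = 0.
Proof.
elim: s j f => [|s IH] [|j] f //=; rewrite !kpart_pair ?kpair0 //.
by rewrite IH contrN IH !oppr0 kpair0.
Qed.

Lemma contr_wedge s j (f : kmod s) : (j < s)%N ->
  contr j (wedge j f) = f - wedge j (contr j f).
Proof.
elim: s j f => [|s IH] [|j] f //= ltjs; rewrite !kpart_pair.
  by rewrite [f in X in _ = X - _]kpairE kpairN kpairD oppr0 addr0 subrr.
rewrite [f in X in _ = X - _]kpairE kpairN kpairD.
by rewrite contrN wedgeN !opprK !IH.
Qed.

Lemma contr_wedge_neq s j k (f : kmod s) : j != k ->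
  contr j (wedge k f) = - wedge k (contr j f).
Proof.
elim: s j k f => [|s IH] [|j] [|k] f //= nejk; rewrite ?oppr0 //.
all: rewrite !kpart_pair kpairN ?contr0 ?wedge0 ?oppr0 ?opprK //.
by congr kpair; rewrite ?contrN ?wedgeN IH ?opprK.
Qed.

End KoszulModel.

Section KoszulDiff.
Variable R : comNzRingType.
Implicit Types (s j n : nat) (x : nat -> R).

Definition kd s x (f : kmod R s) : kmod R s := \sum_(j < s) x j *: contr j f.

Lemma kd_lin s x : linear (@kd s x).
Proof.
move=> a f g; rewrite /kd scaler_sumr -big_split; apply: eq_bigr => j _ /=.
by rewrite linearP scalerDr !scalerA mulrC.
Qed.
HB.instance Definition _ s x :=
  GRing.isLinear.Build R (kmod R s) (kmod R s) *:%R (@kd s x) (@kd_lin s x).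

Lemma kdB s x (f g : kmod R s) : kd x (f - g) = kd x f - kd x g.
Proof. exact: raddfB. Qed.

Lemma kdD s x (f g : kmod R s) : kd x (f + g) = kd x f + kd x g.
Proof. exact: raddfD. Qed.

Lemma kdZ s x a (f : kmod R s) : kd x (a *: f) = a *: kd x f.
Proof. exact: linearZ. Qed.

Lemma kd_pair s x (f : kmod R s.+1) :
  kd x f = kpair (x 0%N *: kpart true f + kd (x \o S) (kpart false f))
                 (- kd (x \o S) (kpart true f)).
Proof.
rewrite {1}/kd big_ord_recl /=.
have -> : \sum_(i < s) x (bump 0 i) *:
      kpair (contr i (kpart false f)) (- contr i (kpart true f))
   = kpair (kd (x \o S) (kpart false f)) (- kd (x \o S) (kpart true f)).
  apply/ffunP => -[b c]; rewrite !ffunE sum_ffunE /kd !sum_ffunE; case: b => /=.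
    by rewrite -sumrN; apply: eq_bigr => i _; rewrite !ffunE /= scalerN.
  by apply: eq_bigr => i _; rewrite !ffunE.
rewrite -[kpair (kd _ _) _]add0r addrC -[x 0%N *: _]addr0.
by apply/ffunP => -[[] c]; rewrite !ffunE /= ?scaler0 ?addr0 ?add0r // addrC.
Qed.

Lemma bdryE s x (f : chain (kos s x)) : bdry f = kd x f.
Proof.
elim: s x f => [|s IH] x f.
  by apply/ffunP => b; rewrite ffunE /kd big_ord0 ffunE big1 // => c _; rewrite mulr0.
rewrite kd_pair -!IH; apply/ffunP => -[c c'].
transitivity (\sum_(b : bool) \sum_(b' : kbasis s)
    (f : kmod R s.+1) (b, b') * @kcoef R s.+1 x (b, b') (c, c')).
  by rewrite ffunE pair_bigA; apply: eq_bigr => -[].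
rewrite big_bool /= !ffunE /=.
have pick (F : kbasis s -> R) : (forall b', b' != c' -> F b' = 0) -> \sum_b' F b' = F c'.
  by move=> F0; rewrite (bigD1 c') //= big1 ?addr0 // => b' /F0.
case: c; rewrite /kdiff /=.
  rewrite [X in _ + X]big1 => [|b' _]; last by rewrite mul0rn mulr0n addr0 mulr0.
  rewrite addr0 -sumrN; apply: eq_bigr => b' _.
  by rewrite mul0rn add0r mulr1n expr1 mulN1r mulrN !ffunE.
congr (_ + _).
  rewrite pick => [|b' /negPf ->]; last by rewrite mulr0n add0r mulr0n mulr0.
  by rewrite eqxx mulr0n addr0 mulr1n mulrC ?ffunE.
apply: eq_bigr => b' _.
by rewrite mul0rn add0r mulr1n expr0 mul1r ffunE.
Qed.

Lemma kd_sq s x (f : kmod R s) : kd x (kd x f) = 0.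
Proof.
elim: s x f => [|s IH] x f; first by rewrite {1}/kd big_ord0.
rewrite !kd_pair !kpart_pair !linearD !linearN /= !IH addr0 kdZ.
by rewrite addNr !oppr0 kpair0.
Qed.

Lemma kd_contr s x j (f : kmod R s) : kd x (contr j f) = - contr j (kd x f).
Proof.
rewrite /kd linear_sum -sumrN; apply: eq_bigr => k _ /=.
by rewrite contrC scalerN contrZ.
Qed.

Lemma kd_perturb s x y j e (f : kmod R s) : (j < s)%N ->
  (forall k, y k = x k + (if k == j then e else 0)) ->
  kd y f = kd x f + e *: contr j f.
Proof.
move=> ltjs hy; rewrite /kd (eq_bigr (fun k : 'I_s =>
  x k *: contr k f + (if k == Ordinal ltjs then e else 0) *: contr k f)).
  rewrite big_split /=; congr (_ + _).
  by rewrite (bigD1 (Ordinal ltjs)) //= eqxx big1 ?addr0 // => k /negPf ->; rewrite scale0r.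
by move=> k _; rewrite hy scalerDl -val_eqE.
Qed.

Definition hdeg s n (f : kmod R s) := forall b, kdeg b != n -> f b = 0.

Lemma submod_hdeg s n : is_submod (@hdeg s n).
Proof.
split=> [b _|a f g fn gn b nb]; rewrite !ffunE //.
by rewrite fn // gn // scaler0 addr0.
Qed.

Lemma hdegP s x n (f : chain (kos s x)) :
  reflect (hdeg n f) (f \in (homog n : {pred chain (kos s x)})).
Proof.
apply: (iffP forallP) => h b; last by apply/implyP; apply: contraNT => /h ->.
by move=> nb; apply/eqP; apply: contraNT nb; apply/implyP/h.
Qed.

Lemma hdeg_part s n b (f : kmod R s.+1) : hdeg (nat_of_bool b + n) f -> hdeg n (kpart b f).
Proof. by move=> fn c nc; rewrite ffunE fn //= eqn_add2l. Qed.

Lemma hdeg0_part s (f : kmod R s.+1) : hdeg 0 f -> kpart true f = 0.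
Proof. by move=> f0; apply/ffunP => c; rewrite !ffunE f0. Qed.

Lemma contr_hdeg0 s j (f : kmod R s) : hdeg 0 f -> contr j f = 0.
Proof.
elim: s j f => [|s IH] [|j] f f0 //=; rewrite (hdeg0_part f0) ?contr0 ?oppr0 ?kpair0 //.
by rewrite IH ?kpair0 //; apply: hdeg_part.
Qed.

Lemma hdeg_contr s n j (f : kmod R s) : hdeg n.+1 f -> hdeg n (contr j f).
Proof.
elim: s n j f => [|s IH] n j f fn; first by move=> b _; rewrite ffunE.
case: j => [|j] [b c] /= nb; rewrite !ffunE //=.
- by case: b nb => nb //; rewrite fn.
- case: b nb => nb; last by rewrite (IH n) //; apply: hdeg_part.
  case: n => [|n] in fn nb *.
    by rewrite contr_hdeg0 ?ffunE ?oppr0 //; apply: hdeg_part.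
  by rewrite (IH n) ?oppr0 //; apply: hdeg_part.
Qed.

Lemma hdeg_wedge s n j (f : kmod R s) : hdeg n f -> hdeg n.+1 (wedge j f).
Proof.
elim: s n j f => [|s IH] n j f fn; first by move=> b _; rewrite ffunE.
case: j => [|j] [b c] /= nb; rewrite !ffunE //=.
- by case: b nb => nb //; rewrite fn.
- case: b nb => nb; last by rewrite (IH n) //; apply: hdeg_part.
  case: n => [|n] in fn nb *.
    by rewrite (hdeg0_part fn) wedge0 ffunE oppr0.
  by rewrite (IH n) ?oppr0 //; apply: hdeg_part.
Qed.

Lemma kdeg_leq s (b : kbasis s) : (kdeg b <= s)%N.
Proof.
elim: s b => [|s IH] //= [b c] /=.
by rewrite -add1n leq_add ?leq_b1.
Qed.

Lemma hdeg_gt s n (f : kmod R s) : (s < n)%N -> hdeg n f -> f = 0.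
Proof.
move=> ltsn fn; apply/ffunP => b; rewrite [RHS]ffunE fn // neq_ltn.
by rewrite (leq_ltn_trans (kdeg_leq b)).
Qed.

Lemma hdeg0_of_contr s (f : kmod R s) : (forall j, (j < s)%N -> contr j f = 0) -> hdeg 0 f.
Proof.
elim: s f => [|s IH] f hf; first by case.
move=> [b c] nb.
have h0 : kpart true f = 0.
  by have := congr1 (kpart false) (hf 0%N isT); rewrite /= kpart_pair => ->; apply: raddf0.
have partE e : f (e, c) = kpart e f c by rewrite ffunE.
case: b nb => /= nb; first by rewrite partE h0 ffunE.
have: hdeg 0 (kpart false f).
  apply: IH => j ltjs; have := congr1 (kpart false) (hf j.+1 ltjs).
  by rewrite /= kpart_pair => ->; apply: raddf0.
by move/(_ c nb); rewrite ffunE.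
Qed.

(** The basis element of degree 0. *)
Fixpoint vac (s : nat) : kbasis s :=
  if s is s'.+1 return kbasis s then (false, vac s') else tt.

Definition kone s : kmod R s := [ffun b => (b == vac s)%:R].

Lemma kdeg_vac s : kdeg (vac s) = 0%N.
Proof. by elim: s. Qed.

Lemma kdeg_eq0 s (b : kbasis s) : kdeg b = 0%N -> b = vac s.
Proof.
elim: s b => [|s IH] //=; first by case.
by case=> [[] c] //= /IH ->.
Qed.

Lemma hdeg0E s (f : kmod R s) : hdeg 0 f -> f = f (vac s) *: kone s.
Proof.
move=> f0; apply/ffunP => b; rewrite !ffunE.
have [->|nb] := eqVneq b (vac s); first by rewrite [RHS]mulr1.
by rewrite f0 ?scaler0 //; apply: contra_neqN nb => /eqP/kdeg_eq0.
Qed.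

Lemma hdeg_one s : hdeg 0 (kone s).
Proof.
move=> b nb; rewrite ffunE; case: eqP => // eb.
by rewrite eb kdeg_vac in nb.
Qed.

Lemma kd_wedge_one s x j : (j < s)%N -> kd x (wedge j (kone s)) = x j *: kone s.
Proof.
move=> ltjs; rewrite /kd (bigD1 (Ordinal ltjs)) //= contr_wedge // big1 => [|k nk].
  by rewrite addr0 (contr_hdeg0 _ (@hdeg_one s)) wedge0 subr0.
rewrite contr_wedge_neq -?val_eqE //.
by rewrite (contr_hdeg0 _ (@hdeg_one s)) wedge0 oppr0 scaler0.
Qed.

Lemma contr_closed s j (J : R^o -> Prop) (f : kmod R s) :
  is_submod J -> (forall b, J (f b)) -> forall b, J (contr j f b).
Proof.
move=> smJ; have J0 := submod0 smJ.
elim: s j f => [|s IH] j f Jf; first by move=> b; rewrite ffunE.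
case: j => [|j] [[] c] /=; rewrite !ffunE //=; rewrite ?ffunE //.
  by apply: (submodN smJ); apply: IH => e; rewrite ffunE.
by apply: IH => e; rewrite ffunE.
Qed.

Lemma adic_contr (I : {pred R}) s n j (f : kmod R s) : adic I n f -> adic I n (contr j f).
Proof. by move=> fn; apply: (contr_closed j (submod_ideal_pow I n)) => b; apply: fn. Qed.

End KoszulDiff.

(** * Annihilation of Koszul homology by a power of the maximal ideal *)

Section Filter.
Variables (R : comNzRingType) (m : idealr R).
Variables (s : nat) (x : nat -> R).

Lemma hdeg_kd n (f : kmod R s) : hdeg n.+1 f -> hdeg n (kd x f).
Proof.
have sm := @submod_hdeg R s n => fn; apply: (submod_sum sm) => j _.
by apply: (submodZ sm); apply: hdeg_contr.
Qed.

Definition span_lt (j : nat) (r : R) :=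
  exists c : nat -> R, r = \sum_(l < j) c l * x l.

(** In filter regular sequences the ideal of the first j elements and its colon
    by the next one differ by a module that a power of m kills. *)
Definition filter_exponent (Q : nat) :=
  forall j, (j < s)%N -> forall a b, a \in ideal_pow m Q ->
    span_lt j (b * x j) -> span_lt j (a * b).

(** Forms that involve only the first j variables. *)
Definition below (j : nat) (f : kmod R s) :=
  forall l, (j <= l < s)%N -> contr l f = 0.

Lemma submod_below j : is_submod (below j).
Proof.
split=> [l _|a f g hf hg l hl]; first exact: contr0.
by rewrite linearP /= hf // hg // scaler0 addr0.
Qed.

(** The coefficient r of e_j in the cycle z satisfies r x_j in (x_0, ..., x_(j-1)),
    because the other contractions of z express r x_j; hence a r lies in that
    ideal as well, and its coefficients there define g. *)
Lemma filter_lift_deg0 Q j (z : kmod R s) a : filter_exponent Q -> (j < s)%N ->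
  hdeg 1 z -> below j.+1 z -> kd x z = 0 -> a \in ideal_pow m Q ->
  exists g, [/\ hdeg 1 g, below j g & a *: contr j z = kd x g].
Proof.
move=> hQ ltjs z1 zj dz aQ; have ltj (l : 'I_j) : (l < s)%N := ltn_trans (ltn_ord l) ltjs.
have b0 : hdeg 0 (contr j z) by apply: hdeg_contr.
set r := contr j z (vac s); have [|c hc] := hQ j ltjs a r aQ.
  exists (fun l => - (contr l z : kmod R s) (vac s)).
  have := congr1 (fun g : {ffun kbasis s -> R^o} => g (vac s)) dz.
  rewrite /kd sum_ffunE ffunE (bigID (fun l : 'I_s => l < j)%N) /=.
  rewrite [X in _ + X](bigD1 (Ordinal ltjs)) ?ltnn //=.
  rewrite [X in _ + (_ + X)]big1 => [|l /andP[lej nlj]]; last first.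
    rewrite ffunE zj ?ffunE ?scaler0 // ltn_ord andbT ltn_neqAle leqNgt lej andbT.
    by rewrite eq_sym -val_eqE in nlj.
  rewrite addr0 addrC => /eqP; rewrite addr_eq0 => /eqP h.
  have -> : r * x j = (x j *: contr j z) (vac s) by rewrite ffunE mulrC.
  rewrite h -sumrN.
  rewrite (big_ord_widen _ (fun l => - (contr l z : kmod R s) (vac s) * x l) (ltnW ltjs)).
  by apply: eq_bigr => l _; rewrite ffunE mulNr mulrC.
exists (\sum_(l < j) c l *: wedge l (kone R s)); split.
- have sm := @submod_hdeg R s 1; apply: (submod_sum sm) => l _; apply: (submodZ sm).
  by apply: hdeg_wedge; apply: hdeg_one.
- move=> k /andP[lejk _]; rewrite linear_sum big1 // => l _.
  rewrite /= contrZ contr_wedge_neq; last by rewrite gtn_eqF // (leq_trans (ltn_ord l)).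
  by rewrite (contr_hdeg0 _ (@hdeg_one R s)) wedge0 oppr0 scaler0.
- rewrite (hdeg0E b0) -/r scalerA hc scaler_suml linear_sum; apply: eq_bigr => l _.
  by rewrite /= kdZ kd_wedge_one // scalerA.
Qed.

(** Write z = z' + e_j b with z' and b free of e_j: b is a cycle of lower degree
    in the previous Koszul complex, so a multiple of it bounds, by induction in
    positive degree and by filter regularity in degree 0.  Subtracting the
    boundary removes e_j from a multiple of z. *)
Lemma filter_annihilates Q j : filter_exponent Q -> (j <= s)%N ->
  exists Qj, forall i z a, hdeg i.+1 z -> below j z -> kd x z = 0 ->
    a \in ideal_pow m Qj -> exists g, [/\ hdeg i.+2 g, below j g & a *: z = kd x g].
Proof.
move=> hQ; elim: j => [|j IH] ltjs.
  exists 0%N => i z a zi z0 _ _; exists 0.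
  have -> : z = 0.
    apply/ffunP => b; rewrite [RHS]ffunE; have [db|db] := eqVneq (kdeg b) i.+1; last exact: zi.
    by apply: (hdeg0_of_contr z0); rewrite db.
  split; [exact: (submod0 (@submod_hdeg R s _)) | exact: (submod0 (submod_below _)) |].
  by rewrite scaler0 linear0.
have {IH} [Qj IH] := IH (ltnW ltjs); exists (Qj + (Qj + Q))%N => i z a zi zj dz.
pose J (a : R^o) := exists g, [/\ hdeg i.+2 g, below j.+1 g & a *: z = kd x g].
have smB := submod_below j.+1; have smH := @submod_hdeg R s i.+2.
have smJ : is_submod J.
  split=> [|c u v [g [g1 g2 g3]] [h [h1 h2 h3]]].
    by exists 0; split; rewrite ?scale0r ?linear0 //; apply: submod0.
  exists (c *: g + h); split; [exact: smH.2 | exact: smB.2 |].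
  by rewrite scalerDl -scalerA g3 h3 linearP.
move: a; apply: (ideal_powD_min smJ) => a2 a1 ha2 ha1.
have [g [gi gj dg]] : exists g, [/\ hdeg i.+1 g, below j g & a1 *: contr j z = kd x g].
  have ha1Q : a1 \in ideal_pow m Q by apply: ideal_pow_leq ha1; apply: leq_addl.
  have ha1j : a1 \in ideal_pow m Qj by apply: ideal_pow_leq ha1; apply: leq_addr.
  case: i => [|i] in zi {J smH smJ} *; first exact: (filter_lift_deg0 hQ ltjs zi zj dz ha1Q).
  apply: IH => //; first exact: hdeg_contr; last by rewrite kd_contr dz contr0 oppr0.
  move=> l /andP[lejl ltls]; have [->|nelj] := eqVneq l j; first exact: contr_sq.
  by rewrite contrC zj ?contr0 ?oppr0 // ltn_neqAle eq_sym nelj lejl.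
have wg : hdeg i.+2 (wedge j g) by apply: hdeg_wedge.
have below_wg : below j.+1 (wedge j g).
  move=> l /andP[ltjl ltls]; rewrite contr_wedge_neq ?gtn_eqF // gj ?wedge0 ?oppr0 //.
  by rewrite ltnW.
have [|||h [hi hj dh]] := IH i (a1 *: z + kd x (wedge j g)) a2 _ _ _ ha2.
- by apply: (@submod_hdeg R s i.+1).2 => //; apply: hdeg_kd.
- move=> l /andP[lejl ltls]; rewrite linearP /=.
  have := kd_contr x l (wedge j g); move/eqP; rewrite eq_sym eqr_oppLR => /eqP ->.
  move: lejl; rewrite leq_eqVlt => /predU1P[<-|ltjl].
    by rewrite contr_wedge // gj ?leqnn // wedge0 subr0 dg subrr.
  by rewrite below_wg ?ltjl // linear0 oppr0 addr0 zj ?scaler0 // ltjl.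
- by rewrite linearP /= dz scaler0 add0r kd_sq.
exists (h - a2 *: wedge j g); split.
- by apply: (submodB smH) => //; apply: (submodZ smH).
- apply: (submodB smB); last exact: (submodZ smB).
  by move=> l /andP[/ltnW lejl ltls]; apply: hj; rewrite lejl.
- by rewrite kdB -dh kdZ scalerDr addrK scalerA.
Qed.

Lemma koszul_annihilated Q : filter_exponent Q ->
  exists Q', forall i (z : kmod R s) a, hdeg i.+1 z -> kd x z = 0 -> a \in ideal_pow m Q' ->
    exists2 g : kmod R s, hdeg i.+2 g & a *: z = kd x g.
Proof.
move=> /filter_annihilates/(_ (leqnn s))[Q' hQ']; exists Q' => i z a zi dz aQ.
have [|g [gi _ dg]] := hQ' i z a zi _ dz aQ; last by exists g.
by move=> l /andP[lesl /(leq_ltn_trans lesl)]; rewrite ltnn.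
Qed.

End Filter.

(** * Perturbing one element *)

Section Perturbation.
Variables (R : comNzRingType) (hR : noetherian R) (m : idealr R).
Variables (hm : local_ring m) (s : nat).
Implicit Types (x : nat -> R) (f g u v w z : kmod R s).

Let smH n := @submod_hdeg R s n.
Let smA n := @submod_adic R m (kbasis s) n.

(** An Artin-Rees bound in degree i: a small boundary of an i-chain is the
    boundary of a small i-chain, and a small i-cycle is the boundary of a small
    chain, with a loss of at most c.  By the second half, m ^ c kills the homology
    in degree i. *)
Definition ar_bound x (i c : nat) :=
  (forall n (y : kmod R s), hdeg i y -> adic m n (kd x y) ->
     exists w, [/\ hdeg i w, adic m (n - c) w & kd x w = kd x y]) /\
  (forall n z, (c <= n)%N -> hdeg i z -> kd x z = 0 -> adic m n z ->
     exists u, [/\ hdeg i.+1 u, adic m (n - c) u & z = kd x u]).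

Lemma ar_bound_leq x i c c' : (c <= c')%N -> ar_bound x i c -> ar_bound x i c'.
Proof.
move=> lecc' [bA bB]; split=> [n y yi dy|n z len zi dz zn].
  have [w [wi wn dw]] := bA n y yi dy; exists w; split=> //.
  by apply: adic_leq wn; apply: leq_sub2l.
have [u [ui un du]] := bB n z (leq_trans lecc' len) zi dz zn; exists u; split=> //.
by apply: adic_leq un; apply: leq_sub2l.
Qed.

Lemma ar_bound_gt x i : (s < i)%N -> ar_bound x i 0.
Proof.
move=> ltsi; split=> [n y yi dy|n z _ zi _ _].
  by exists y; split=> //; rewrite (hdeg_gt ltsi yi); apply: (submod0 (smA _)).
exists 0; split; [exact: (submod0 (smH _)) | exact: (submod0 (smA _)) |].
by rewrite (hdeg_gt ltsi zi) linear0.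
Qed.

Lemma submod_kd_im x i n :
  is_submod (fun g => exists w, [/\ hdeg i w, adic m n w & kd x w = g]).
Proof.
split=> [|a f g [v [vi vn <-]] [w [wi wn <-]]].
  by exists 0; split; [exact: (submod0 (smH _)) | exact: (submod0 (smA _)) | exact: linear0].
by exists (a *: v + w); split; [exact: (smH _).2 | exact: (smA _).2 | exact: linearP].
Qed.

(** The loss is the one of the Artin-Rees lemma for boundaries, respectively
    for cycles; to pass from cycles to boundaries costs Q more. *)
Lemma ar_bound_ex1 x i Q :
  (forall z a, hdeg i z -> kd x z = 0 -> a \in ideal_pow m Q ->
     exists2 g, hdeg i.+1 g & a *: z = kd x g) ->
  exists c, ar_bound x i c.
Proof.
move=> hQ; have hI := idealr_submod m.
have smL : is_submod (fun g => exists2 y, hdeg i y & kd x y = g).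
  exact: (is_submod_im (@kd_lin R s x) (smH i)).
have smZ : is_submod (fun z => hdeg i z /\ kd x z = 0).
  apply: is_submodI (smH i) _; split=> [|a f g df dg]; first exact: linear0.
  by rewrite linearP /= df dg scaler0 addr0.
have [c1 hc1] := artin_rees hR hI smL; have [c2 hc2] := artin_rees hR hI smZ.
exists (c1 + c2 + Q)%N; split=> [n y yi dy|n z len zi dz zn].
  have Ly : exists2 y', hdeg i y' & kd x y' = kd x y by exists y.
  have [p g pn [y' y'i <-]|w [wi wn dw]] :=
    hc1 n (kd x y) Ly dy _ (submod_kd_im x i (n - (c1 + c2 + Q))); last by exists w.
  exists (p *: y'); rewrite kdZ; split=> //; first exact: (submodZ (smH i)).
  have y'0 : adic m 0 y' by [].
  by apply: adic_leq (adicZ pn y'0); lia.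
have smN := submod_kd_im x i.+1 (n - (c1 + c2 + Q)).
have [p g pn [gi dg]|u [ui un du]] := hc2 n z (conj zi dz) zn _ smN; last by exists u.
have lin1 : linear (fun r : R^o => r *: g) by move=> a u v; rewrite scalerDl scalerA.
have pn' : p \in ideal_pow m ((n - c2 - Q) + Q) by apply: ideal_pow_leq pn; lia.
move: p {pn} pn'; apply: (ideal_powD_min (is_submod_preim lin1 smN)) => a b an bQ.
have [h hi dh] := hQ g b gi dg bQ.
exists (a *: h); rewrite kdZ -dh scalerA; split=> //; first exact: (submodZ (smH _)).
have h0 : adic m 0 h by [].
by apply: adic_leq (adicZ an h0); lia.
Qed.

Lemma ar_bound_ex x Q : filter_exponent m s x Q ->
  exists c, forall i, (0 < i)%N -> ar_bound x i c.
Proof.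
move=> /koszul_annihilated[Q' hQ'].
suff /(_ s)[c hc] : forall k, exists c, forall i, (0 < i <= k)%N -> ar_bound x i c.
  exists c => i i0; have [leis|ltsi] := leqP i s; first by apply: hc; rewrite i0.
  exact: ar_bound_leq (ar_bound_gt x ltsi).
elim=> [|k [c hc]]; first by exists 0%N => -[].
have [|d hd] := @ar_bound_ex1 x k.+1 Q'; first exact: hQ'.
exists (maxn c d) => i /andP[i0]; rewrite leq_eqVlt => /predU1P[->|ltik].
  by apply: ar_bound_leq hd; apply: leq_maxr.
by apply: ar_bound_leq (hc i _); rewrite ?leq_maxl // i0.
Qed.

Section Step.
Variables (x y : nat -> R) (j N : nat) (e : R) (i c : nat).
Hypotheses (ltjs : (j < s)%N) (hy : forall k, y k = x k + (if k == j then e else 0)).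
Hypotheses (eN : e \in ideal_pow m N) (hx : ar_bound x i c) (ltcN : (c < N)%N).

Let kdy f : kd y f = kd x f + e *: contr j f := kd_perturb f ltjs hy.

Lemma adic_pert n f : adic m n f -> adic m (N + n) (e *: contr j f).
Proof. by move=> fn; apply: adicZ => //; apply: adic_contr. Qed.

(** If e z = d u then z + iota u is a cycle of the perturbed differential
    d + e iota, because iota anticommutes with d and has square zero.  The
    bound makes u small. *)
Lemma lift_cycle n z : hdeg i z -> kd x z = 0 -> adic m n z ->
  exists z', [/\ hdeg i z', kd y z' = 0 & adic m (N + n - c) (z' - z)].
Proof.
move=> zi dz zn.
have [||||u [ui un du]] := hx.2 (N + n)%N (e *: z).
- by rewrite (leq_trans (ltnW ltcN)) ?leq_addr.
- exact: (submodZ (smH i)).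
- by rewrite kdZ dz scaler0.
- exact: adicZ.
exists (z + contr j u); split.
- by apply: (submodD (smH i)) => //; apply: hdeg_contr.
- rewrite kdy kdD dz add0r kd_contr -du contrZ linearD /= contr_sq addr0.
  by rewrite addNr.
- by rewrite addrAC subrr add0r; apply: adic_contr.
Qed.

(** A preimage of order k < n - c is improved to order k + 1: up to a small
    chain it is a cycle of the old differential, and [lift_cycle] turns this
    into a cycle of the new one, which can be subtracted. *)
Lemma perturbed_small_preimage n f : hdeg i f -> adic m n (kd y f) ->
  exists w, [/\ hdeg i w, adic m (n - c) w & kd y w = kd y f].
Proof.
move=> fi dfn.
suff H k : (k <= n - c)%N -> exists w, [/\ hdeg i w, adic m k w & kd y w = kd y f].
  exact: H.
elim: k => [|k IH] lek; first by exists f.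
have [w [wi wk dw]] := IH (ltnW lek).
have dwx : kd x w = kd y f - e *: contr j w by rewrite -dw kdy addrK.
have [|w1 [w1i w1k dw1]] := hx.1 (c + k.+1)%N w wi.
  rewrite dwx; apply: (submodB (smA _)); first by apply: adic_leq dfn; lia.
  by apply: adic_leq (adic_pert wk); lia.
have w1k' : adic m k.+1 w1 by apply: adic_leq w1k; lia.
have [|||z' [z'i dz' z'k]] := @lift_cycle k (w - w1).
- exact: (submodB (smH i)).
- by rewrite kdB dw1 subrr.
- by apply: (submodB (smA k)) => //; apply: adic_leq w1k'.
exists (w - z'); split; first exact: (submodB (smH i)).
- have -> : w - z' = w1 - (z' - (w - w1)) by rewrite opprB addrA [w1 + _]addrC subrK.
  by apply: (submodB (smA _)) => //; apply: adic_leq z'k; lia.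
- by rewrite kdB dz' subr0.
Qed.

(** A cycle of order n + k is, up to order n + k + 1, the boundary of a chain of
    order n + k - c; iterating puts it in the closure of the boundaries of chains
    of order n - c, and Krull's theorem applies. *)
Lemma perturbed_small_cycle n z : (c <= n)%N -> hdeg i z -> kd y z = 0 ->
  adic m n z -> exists u, [/\ hdeg i.+1 u, adic m (n - c) u & z = kd y u].
Proof.
move=> len zi dz zn.
suff [u [ui un du]] : exists u, [/\ hdeg i.+1 u, adic m (n - c) u & kd y u = z].
  by exists u.
apply: (krull hR hm (submod_kd_im y i.+1 (n - c))) => k.
suff [u [ui un uk]] : exists u,
    [/\ hdeg i.+1 u, adic m (n - c) u & adic m (n + k) (z - kd y u)].
  by exists (kd y u); [exists u | apply: adic_leq uk; apply: leq_addl].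
elim: k => [|k [u [ui un uk]]].
  exists 0; rewrite linear0 subr0 addn0.
  by split; [exact: (submod0 (smH _)) | exact: (submod0 (smA _)) |].
set f := z - kd y u in uk.
have fi : hdeg i f by apply: (submodB (smH i)) => //; apply: hdeg_kd.
have df : kd y f = 0 by rewrite kdB dz kd_sq subr0.
have dfx : kd x f = - (e *: contr j f) by apply/eqP; rewrite -addr_eq0 -kdy df.
have [|w [wi wk dw]] := hx.1 (N + (n + k))%N f fi.
  by rewrite dfx; apply: (submodN (smA _)); apply: adic_pert.
have wk' : adic m (n + k).+1 w by apply: adic_leq wk; lia.
have [||||v [vi vk dv]] := hx.2 (n + k)%N (f - w).
- by rewrite (leq_trans len) ?leq_addr.
- exact: (submodB (smH i)).
- by rewrite kdB dw subrr.
- by apply: (submodB (smA _)) => //; apply: adic_leq wk'.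
exists (u + v); split.
- exact: (submodD (smH _)).
- by apply: (submodD (smA _)) => //; apply: adic_leq vk; lia.
- have -> : z - kd y (u + v) = w - e *: contr j v.
    rewrite kdD opprD addrA -/f kdy -dv opprD addrA opprB addrCA subrr addr0 //.
  rewrite addnS; apply: (submodB (smA _)) => //.
  by apply: adic_leq (adic_pert vk); lia.
Qed.

(** The bound does not deteriorate, so the elements of the sequence can be
    perturbed one after the other. *)
Lemma ar_bound_perturb : ar_bound y i c.
Proof. by split; [exact: perturbed_small_preimage | exact: perturbed_small_cycle]. Qed.

End Step.

(** Classes of the two complexes correspond when they have representatives that
    agree up to order c.  Cycles of order c bound, so the correspondence is
    injective; cycles lift, so it is total. *)
Definition close_cycles x (y : nat -> R) i c
    (v : homology (kos s x) i) (w : homology (kos s y) i) :=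
  exists f g : kmod R s, [/\ represents v f, represents w g & adic m c (f - g)].

Lemma cyclesP x i (f : chain (kos s x)) :
  f \in (cycles i : {pred chain (kos s x)}) <-> hdeg i f /\ kd x f = 0.
Proof.
rewrite inE bdryE; split=> [/andP[/hdegP fi /eqP]|[/hdegP -> ->]] //.
exact: eqxx.
Qed.

Lemma boundariesP x i (f : chain (kos s x)) :
  f \in (boundaries i : {pred chain (kos s x)}) <->
  exists2 g : kmod R s, hdeg i.+1 g & f = kd x g.
Proof.
rewrite inE; split=> [/asboolP[g /hdegP gi ->]|[g gi ->]].
  by exists g; rewrite ?bdryE.
by apply/asboolP; exists g; [apply/hdegP | rewrite bdryE].
Qed.

Lemma close_cycles_corr x y j N e i c : (j < s)%N ->
  (forall k, y k = x k + (if k == j then e else 0)) ->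
  e \in ideal_pow m N -> ar_bound x i c -> (c + c < N)%N ->
  correspondence (@close_cycles x y i c).
Proof.
move=> ltjs hy eN hx ltN; have ltcN : (c < N)%N by lia.
split.
- move=> a v v' w w' [f [g [vf wg fg]]] [f' [g' [vf' wg' fg']]].
  exists (a *: f + f'), (a *: g + g'); split; [exact: represents_lin.. |].
  by rewrite opprD addrACA -scalerBr; apply: (smA c).2.
- move=> v; have [f /cyclesP[fi df] vf] := represents_ex v.
  have f0 : adic m 0 f by [].
  have [g [gi dg fg]] := lift_cycle ltjs hy eN hx ltcN fi df f0.
  have [|w wg] := @ex_represents _ _ (cycles i) (boundaries i) (g : chain (kos s y)).
    exact/cyclesP.
  exists w, f, g; split=> //; rewrite -opprB; apply: (submodN (smA c)).
  by apply: adic_leq fg; lia.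
- move=> v [f [g [vf wg fg]]]; apply/(represents0 vf)/boundariesP.
  have /boundariesP[u ui du] := (represents0 wg).1 erefl.
  have [hf _] := vf; have /cyclesP[fi df] := hf.
  have [|||| t [ti _ dt]] := hx.2 c (f - kd x u).
  + by [].
  + by apply: (submodB (smH i)) => //; apply: hdeg_kd.
  + by rewrite kdB df kd_sq subr0.
  + have -> : f - kd x u = (f - g) + e *: contr j u.
      by rewrite du (kd_perturb u ltjs hy) opprD addrA subrK.
    apply: (submodD (smA c)) => //.
    have u0 : adic m 0 u by [].
    by apply: adic_leq (adicZ eN (adic_contr j u0)); lia.
  exists (t + u); first exact: (submodD (smH _)).
  by rewrite kdD -dt subrK.
Qed.

Lemma mlength_perturb x y j N e i c : (j < s)%N ->
  (forall k, y k = x k + (if k == j then e else 0)) ->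
  e \in ideal_pow m N -> ar_bound x i c -> (c + c < N)%N ->
  mlength (homology (kos s x) i) = mlength (homology (kos s y) i).
Proof.
move=> ltjs hy eN hx ltN; have ltcN : (c < N)%N by lia.
have hy' k : x k = y k + (if k == j then - e else 0).
  by rewrite hy; case: eqP => _; rewrite ?addr0 // addrK.
have eN' : - e \in ideal_pow m N := submodN (submod_ideal_pow m N) eN.
have hb := ar_bound_perturb ltjs hy eN hx ltcN.
apply: (mlength_corr (close_cycles_corr ltjs hy eN hx ltN)).
have [cP cV cI] := close_cycles_corr ltjs hy' eN' hb ltN.
have sym (v : homology (kos s x) i) (w : homology (kos s y) i) :
    close_cycles c v w <-> close_cycles c w v.
  by split=> -[f [g [vf wg fg]]]; exists g, f; split=> //; rewrite -opprB;
    apply: (submodN (smA c)).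
split=> [a v v' w w' /sym h /sym h'|v|v /sym]; first by apply/sym; apply: cP.
- by have [w] := cV v; exists w; apply/sym.
- exact: cI.
Qed.

End Perturbation.

(** * Filter regular sequences *)

Lemma span_ltP (R : comNzRingType) (l : seq R) (j : nat) (r : R) : (j <= size l)%N ->
  r \in ideal_gen (take j l) <-> span_lt (nth 0 l) j r.
Proof.
move=> lej; split=> [/ideal_genP[c ->]|[c ->]].
  exists c; rewrite size_takel //; apply: eq_bigr => i _; by rewrite nth_take.
apply/ideal_genP; exists c; rewrite size_takel //.
by apply: eq_bigr => i _; rewrite nth_take.
Qed.

Lemma filter_regular_exponent (R : comNzRingType) (hR : noetherian R) (m : idealr R)
  (l : seq R) : filter_regular m l ->
  exists Q, filter_exponent m (size l) (nth 0 l) Q.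
Proof.
move=> hl.
suff [Q hQ] : exists Q, forall j, (j < size l)%N -> forall a u, a \in ideal_pow m Q ->
    u * l`_j \in ideal_gen (take j l) -> a * u \in ideal_gen (take j l).
  exists Q => j ltj a b aQ /(span_ltP _ (ltnW ltj)) h.
  by apply/(span_ltP _ (ltnW ltj)); apply: hQ.
elim: {-2}(size l) (leqnn (size l)) => [|k IH] lek; first by exists 0%N.
have [Q hQ] := IH (ltnW lek); have [n hn] := colon_pow hR (hl k lek).
exists (maxn Q n) => j; rewrite ltnS leq_eqVlt => /predU1P[->|ltjk] a u ha hu.
  by apply: hn hu; apply: ideal_pow_leq ha; apply: leq_maxr.
by apply: hQ hu => //; apply: ideal_pow_leq ha; apply: leq_maxl.
Qed.

Theorem theorem2 (R : comNzRingType) (m : idealr R) (s : nat) (x : s.-tuple R)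
    (hnoeth : noetherian R) (hlocal : local_ring m) (hx : filter_regular m x) :
  exists2 N : nat, (0 < N)%N &
    forall e : s.-tuple R, (forall j : 'I_s, tnth e j \in ideal_pow m N) ->
    forall i : nat, (1 <= i)%N ->
      mlength (homology (koszul [tuple tnth x j + tnth e j | j < s]) i) =
      mlength (homology (koszul x) i).
Proof.
have [Q] := filter_regular_exponent hnoeth hx; rewrite size_tuple => hQ.
have [c hc] := ar_bound_ex hnoeth hQ.
exists (c + c).+1 => // e eN i i0; rewrite !koszulE !size_tuple.
(* The sequence with its first k elements perturbed. *)
pose y k l := nth 0 x l + (if (l < k)%N then nth 0 e l else 0).
have y0 : y 0%N = nth 0 x by apply/funext => l; rewrite /y addr0.
have ys : nth 0 [tuple tnth x j + tnth e j | j < s] = y s.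
  apply/funext => l; rewrite /y; case: ltnP => [ltls|lesl].
    rewrite -(tnth_nth 0 _ (Ordinal ltls)) tnth_mktuple.
    by rewrite !(tnth_nth 0).
  by rewrite !nth_default ?size_tuple ?addr0.
rewrite ys -y0.
suff H k : (k <= s)%N -> @ar_bound R m s (y k) i c /\
    mlength (homology (kos s (y k)) i) = mlength (homology (kos s (y 0%N)) i).
  by have [] := H s (leqnn s).
elim: k => [|k IH] lek; first by split=> //; rewrite y0; apply: hc.
have [hb <-] := IH (ltnW lek).
have eN' : nth 0 e k \in ideal_pow m (c + c).+1.
  by have := eN (Ordinal lek); rewrite (tnth_nth 0).
have hy l : y k.+1 l = y k l + (if l == k then nth 0 e k else 0).
  rewrite /y -addrA; congr (_ + _); rewrite ltnS leq_eqVlt.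
  by have [->|nlk] := eqVneq l k; rewrite ?ltnn ?add0r ?addr0.
have ltcN : (c < (c + c).+1)%N by rewrite ltnS leq_addr.
split; first exact: (ar_bound_perturb hnoeth hlocal lek hy eN' hb ltcN).
by rewrite (mlength_perturb hnoeth hlocal lek hy eN' hb (ltnSn _)).
Qed.
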